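(* Let $m\ge 1$ be odd and $1\le n\le 2m-1$. Then any radial solution of $(-\Delta)^m u=e^u$ in $\mathbb{R}^n$ is stable outside a compact set.
   Context: Solutions are classical and defined on all of $\mathbb{R}^n$. For $m$ odd, a solution $u\in C^{2m}(\mathbb{R}^n)$ of $(-\Delta)^m u=e^u$ in $\mathbb{R}^n$ is called stable outside a compact set $K\subset\mathbb{R}^n$ if $$\int_{\mathbb{R}^n}|\nabla(\Delta^{\frac{m-1}{2}}\varphi)|^2dx-\int_{\mathbb{R}^n}e^u\varphi^2dx\ge 0\qquad\text{for any }\varphi\in C^\infty_c(\mathbb{R}^n\setminus K).$$ It is stable outside a compact set if such a $K$ exists. *)

(* Defs.v *)
From HB Require Import structures.
From mathcomp Require Import all_boot all_order all_algebra.
From mathcomp Require Import all_classical all_reals all_analysis.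

Set Implicit Arguments.
Unset Strict Implicit.
Unset Printing Implicit Defensive.

Import Order.TTheory GRing.Theory Num.Theory.
Import numFieldNormedType.Exports.

Local Open Scope classical_set_scope.
Local Open Scope ring_scope.

Section lebesgue_measure_step.
Context {R : realType} {n : nat}.
Local Open Scope ereal_scope.

Definition tcons (p : measurableTypeR R * n.-tuple (measurableTypeR R)) :
  n.+1.-tuple (measurableTypeR R) := [the n.+1.-tuple _ of p.1 :: p.2].

Lemma measurable_tcons : measurable_fun setT tcons.
Proof. exact: measurable_cons. Qed.

Lemma tcons_preimage (A : 'I_n.+1 -> set (measurableTypeR R)) :
  tcons @^-1` [set t | forall i, A i (tnth t i)] =
  A ord0 `*` [set t | forall i, A (lift ord0 i) (tnth t i)].
Proof.
apply/seteqP; split=> [[x t] /= At|[x t] /= [A0 At] i].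
  by split=> [|i]; [exact: (At ord0)|have := At (lift ord0 i); rewrite tnthS].
by case: (unliftP ord0 i) => [j|] ->; [rewrite tnthS|].
Qed.

Definition tdec (t : n.+1.-tuple (measurableTypeR R)) :
  measurableTypeR R * n.-tuple (measurableTypeR R) :=
  (thead t, [tuple of behead t]).

Lemma measurable_tdec : measurable_fun setT tdec.
Proof.
apply: measurable_fun_pair; first exact: measurable_tnth.
exact: measurable_behead.
Qed.

Lemma measurable_tbox k (A : 'I_k -> set (measurableTypeR R)) :
  (forall i, measurable (A i)) ->
  measurable [set t : k.-tuple (measurableTypeR R) | forall i, A i (tnth t i)].
Proof.
move=> mA; rewrite (_ : mkset _ =
    \big[setI/setT]_(i < k) ((@tnth k _)^~ i @^-1` A i)).
  apply: bigsetI_measurable => i _; rewrite -[X in measurable X]setTI.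
  exact: measurable_tnth.
rewrite -bigcap_seq; apply/seteqP; split=> [t At i _|t At i]; first exact: At.
by apply: At; rewrite /= mem_index_enum.
Qed.

Variable mu : {sigma_finite_measure set (n.-tuple (measurableTypeR R)) -> \bar R}.

Definition lebesgue_step : set (n.+1.-tuple (measurableTypeR R)) -> \bar R :=
  pushforward (@lebesgue_measure R \x mu) tcons.

Let lebesgue_step0 : lebesgue_step set0 = 0.
Proof. by rewrite /lebesgue_step /pushforward preimage_set0 measure0. Qed.

Let lebesgue_step_ge0 A : 0 <= lebesgue_step A.
Proof. by rewrite /lebesgue_step /pushforward measure_ge0. Qed.

Let lebesgue_step_sigma_additive : semi_sigma_additive lebesgue_step.
Proof.
move=> F mF tF mUF; rewrite /lebesgue_step /pushforward preimage_bigcup.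
apply: (@measure_semi_sigma_additive _ _ _ (@lebesgue_measure R \x mu)%E).
- by move=> i; rewrite -[X in measurable X]setTI; exact: measurable_tcons.
- apply/trivIsetP => /= i j _ _ ij; rewrite -preimage_setI.
  by move/trivIsetP : tF => /(_ _ _ _ _ ij) ->//; rewrite preimage_set0.
- rewrite -preimage_bigcup -[X in measurable X]setTI.
  exact: measurable_tcons.
Qed.

HB.instance Definition _ := isMeasure.Build _ _ _ lebesgue_step
  lebesgue_step0 lebesgue_step_ge0 lebesgue_step_sigma_additive.

Lemma lebesgue_step_box (A : 'I_n.+1 -> set (measurableTypeR R)) :
  (forall i, measurable (A i)) ->
  lebesgue_step [set t | forall i, A i (tnth t i)] =
  lebesgue_measure (A ord0) *
  mu [set t | forall i, A (lift ord0 i) (tnth t i)].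
Proof.
move=> mA; rewrite /lebesgue_step /pushforward tcons_preimage.
rewrite product_measure1E//.
exact: (@measurable_tbox _ (fun i => A (lift ord0 i)) (fun i => mA _)).
Qed.

Let lebesgue_step_sigma_finite : sigma_finite setT lebesgue_step.
Proof.
have /sigma_finiteP[F [TF ndF Foo]] := sigma_finiteT (@lebesgue_measure R).
have /sigma_finiteP[G [TG ndG Goo]] := sigma_finiteT mu.
exists (fun k => tdec @^-1` (F k `*` G k)).
  apply/seteqP; split=> // t _.
  have [i _ Fi] : (\bigcup_k F k) (tdec t).1 by rewrite -TF.
  have [j _ Gj] : (\bigcup_k G k) (tdec t).2 by rewrite -TG.
  exists (maxn i j) => //; split.
    by move: Fi; exact/subsetPset/ndF/leq_maxl.
  by move: Gj; exact/subsetPset/ndG/leq_maxr.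
move=> k; have [mF Fk] := Foo k; have [mG Gk] := Goo k; split.
  rewrite -[X in measurable X]setTI.
  by apply: measurable_tdec => //; exact: measurableX.
have tconsK : cancel tcons tdec.
  by move=> [x t]; congr pair; apply/val_inj.
rewrite /lebesgue_step /pushforward -comp_preimage.
rewrite (_ : tdec \o tcons = id); last exact/funext.
by rewrite product_measure1E// lte_mul_pinfty// ge0_fin_numE.
Qed.

HB.instance Definition _ := Measure_isSigmaFinite.Build _ _ _ lebesgue_step
  lebesgue_step_sigma_finite.

End lebesgue_measure_step.

(* n-dimensional Lebesgue measure (on Borel sets): the n-fold product of the
   one-dimensional one, the 0-dimensional one being a unit point mass. *)
Fixpoint lebesgueRn (R : realType) (n : nat) :
    {sigma_finite_measure set (n.-tuple (measurableTypeR R)) -> \bar R} :=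
  match n with
  | 0 => dirac (nil_tuple (measurableTypeR R))
  | n'.+1 => lebesgue_step (lebesgueRn R n')
  end.

Lemma lebesgueRn_box (R : realType) (n : nat)
    (A : 'I_n -> set (measurableTypeR R)) :
  (forall i, measurable (A i)) ->
  (lebesgueRn R n [set t | forall i, A i (tnth t i)] =
   \prod_(i < n) lebesgue_measure (A i))%E.
Proof.
elim: n A => [|n IHn] A mA.
  rewrite big_ord0 /= diracE mem_set//= => -[].
  by [].
by rewrite big_ord_recl -IHn//= lebesgue_step_box.
Qed.

(* Integration is over tuples because they, unlike 'rV[R]_n, carry the product
   sigma-algebra; the two are identified coordinatewise. *)
Definition intRn (R : realType) (n : nat) (f : 'rV[R]_n -> R) : R :=
  \int[lebesgueRn R n]_t f (\row_i tnth t i).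

Section calculus.
Context {R : realType} {n : nat}.
Implicit Types (f u phi : 'rV[R]_n -> R) (K : set 'rV[R]_n).

(* The library norm `|x| on 'rV[R]_n is the max norm. *)
Definition enorm (x : 'rV[R]_n) : R := Num.sqrt (\sum_i x 0 i ^+ 2).

Definition partial (i : 'I_n) f : 'rV[R]_n -> R :=
  fun x => 'D_(delta_mx 0 i) f x.

Definition grad f : 'rV[R]_n -> 'rV[R]_n := fun x => \row_i partial i f x.

Definition laplacian f : 'rV[R]_n -> R :=
  fun x => \sum_i partial i (partial i f) x.

Fixpoint Ck (k : nat) f : Prop :=
  match k with
  | 0 => continuous f
  | k'.+1 => continuous f /\
      forall i, (forall x, derivable f x (delta_mx 0 i)) /\ Ck k' (partial i f)
  end.

Definition Csmooth f : Prop := forall k, Ck k f.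

(* C^oo_c(R^n \ K), for K closed: the functions are extended by 0 to R^n. *)
Definition test_function K phi : Prop :=
  [/\ Csmooth phi,
      compact (closure [set x | phi x != 0]) &
      closure [set x | phi x != 0] `<=` ~` K].

Definition radial u : Prop := exists g : R -> R, forall x, u x = g (enorm x).

Definition solution (m : nat) u : Prop :=
  Ck (2 * m) u /\
  forall x, iter m (fun f y => - laplacian f y) u x = expR (u x).

Definition stable_outside (m : nat) u K : Prop :=
  forall phi, test_function K phi ->
    0 <= intRn (fun x => enorm (grad (iter (m - 1)./2 laplacian phi) x) ^+ 2)
         - intRn (fun x => expR (u x) * phi x ^+ 2).

Definition stable_outside_compact_set (m : nat) u : Prop :=
  exists K, compact K /\ stable_outside m u K.

End calculus.

(* Main.v *)
Require Import Defs.
From mathcomp Require Import all_boot all_order all_algebra.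
From mathcomp Require Import all_classical all_reals all_analysis.
From mathcomp Require Import measurable_realfun.
From mathcomp Require Import ring lra zify.

Set Implicit Arguments.
Unset Strict Implicit.
Unset Printing Implicit Defensive.

Import Order.TTheory GRing.Theory Num.Theory.
Import numFieldNormedType.Exports.

Local Open Scope classical_set_scope.
Local Open Scope ring_scope.

(** The proof has two independent halves: e^u decays exponentially, and the
    quadratic form of (-Delta)^m controls the L^2 norm with a polynomially
    decaying weight, for functions vanishing near the origin.

    Decay. Put V_j = (-Delta)^(m-j) u, so that V_0 = e^u > 0, V_m = u and
    -Delta V_(j+1) = V_j, all these functions being radial. Positivity of V_j
    makes the flux r^(n-1) V_(j+1)' negative, so V_(j+1) decreases in r. If some
    V_j with 0 < j < m becomes negative, it stays below a negative constant, and
    a function whose Laplacian is bounded away from 0 near infinity grows at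
    least quadratically (radial_laplacian_growth); going up the chain, |u| grows
    quadratically. The sign must be negative: were u to tend to +oo, V_0 = e^u
    would be bounded below and the chain, which has odd length m, would drive u
    to -oo. In the remaining case all V_j with j < m are positive, and
    integrating the flux repeatedly gives r^(n-1) V_j' <= - a r^(2j-2) for
    r >= 1, since a positive decreasing V_j(r) is at least V_j(r) - V_j(2r). For
    j = m this is r^(n-1) u' <= - a r^(2m-2), and n <= 2m - 1 yields u' <= - a.
    In every case u(x) <= - c |x| near infinity (chain_linear_decay,
    radial_solution_decay).

    Coercivity. Integrating the divergence of x (1 + |x|^2)^(-b) phi^2 gives a
    weighted Hardy inequality which trades one derivative against two powers of
    |x| (weighted_hardy). Because b may be taken large, the coefficient of phi^2
    has a sign away from the origin whatever the dimension, and m steps bound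
    the integral of (1 + |x|^2)^(-n-m) phi^2 by a constant times the sum of the
    squared L^2 norms of all m-th order derivatives of phi (weighted_energy).
    By integration by parts that sum equals the squared L^2 norm of
    grad (Delta^((m-1)/2) phi) (energy_iter_laplacian, energy1E).

    Outside a large cube e^u is at most a small multiple of
    (1 + |x|^2)^(-n-m), which gives the stability inequality there. *)

(** * Partial derivatives and the classes Ck *)

Lemma mean_value (R : realType) (f df : R -> R) (a b : R) : a < b ->
  (forall s, a <= s <= b -> is_derive s 1 f (df s)) ->
  exists2 c, a < c < b & f b - f a = df c * (b - a).
Proof.
move=> ab dfE; have [s||c] := @MVT R f df a b ab.
- by rewrite in_itv /= => /andP[/ltW ? /ltW ?]; apply: dfE; apply/andP.
- apply: derivable_within_continuous => s; rewrite in_itv /= => /dfE.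
  by case.
- by rewrite in_itv /=; exists c.
Qed.

Section directional_calculus.
Context {R : realType} {n : nat}.
Implicit Types (f g : 'rV[R]_n -> R) (x v : 'rV[R]_n) (s t : R).

(** Directional derivatives are one-variable derivatives along lines; the mean
    value theorem and the chain rule are transferred through this. *)
Lemma is_derive_line f x v t d :
  is_derive t 1 (fun s : R => f (x + s *: v)) d <->
  is_derive (x + t *: v) v f d.
Proof.
have E : (fun h : R => h^-1 *: (f (x + (h *: 1 + t) *: v) - f (x + t *: v))) =
  (fun h => h^-1 *: (f (h *: v + (x + t *: v)) - f (x + t *: v))).
  apply/funext => h; congr (_ *: (f _ - _)).
  by rewrite scalerDl addrCA [h *: 1]mulr1.
split=> -[d1 d2]; split.
- by move: d1; rewrite /derivable /= E.
- by move: d2; rewrite /derive /= E.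
- by rewrite /derivable /= E.
- by rewrite /derive /= E.
Qed.

Lemma is_derive_line0 f x v d :
  is_derive (0 : R) 1 (fun s : R => f (x + s *: v)) d <-> is_derive x v f d.
Proof. by rewrite -[X in is_derive X v f]addr0 -(scale0r v) is_derive_line. Qed.

Lemma is_derive_partial f x i :
  derivable f x (delta_mx 0 i) -> is_derive x (delta_mx 0 i) f (partial i f x).
Proof. exact: derivableP. Qed.

Lemma partial_val f x i d :
  is_derive x (delta_mx 0 i) f d -> partial i f x = d.
Proof. by case. Qed.

Lemma is_derive_coord x v j :
  is_derive x v (fun y : 'rV[R]_n => y 0 j) (v 0 j).
Proof.
rewrite -[x]addr0 -(scale0r v); apply/is_derive_line.
have -> : (fun s : R => (x + s *: v) 0 j) = cst (x 0 j) + v 0 j *: id.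
  by apply/funext => s; rewrite !mxE /= /GRing.scale /= mulrC.
have d := is_deriveD (is_derive_cst (x 0 j) (0:R) (1:R))
  (is_deriveZ (v 0 j) (is_derive_id (0:R) (1:R))).
by apply: (is_derive_eq d); rewrite add0r [_ *: _]mulr1.
Qed.

Lemma continuous_line f x v :
  continuous f -> continuous (fun s : R => f (x + s *: v)).
Proof.
move=> cf s; apply: (@continuous_comp _ _ _ (fun s : R => x + s *: v) f).
  apply: cvgD; first exact: cvg_cst.
  by apply: cvgZ; [exact: cvg_id|exact: cvg_cst].
exact: cf.
Qed.

Lemma continuous_mul f g : continuous f -> continuous g ->
  continuous (fun x => f x * g x).
Proof. by move=> cf cg x; exact: (continuousM (cf x) (cg x)). Qed.

Lemma Ck_continuous k f : Ck k f -> continuous f.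
Proof. by case: k => [//|k] []. Qed.

Lemma CkS k f : Ck k.+1 f -> Ck k f.
Proof.
elim: k f => [|k IH] f [cf df]; first exact: cf.
by split=> // i; have [di ci] := df i; split=> //; exact: IH.
Qed.

Lemma Ck_leq k l f : (k <= l)%N -> Ck l f -> Ck k f.
Proof.
move=> /subnK <-; elim: (l - k)%N => [//|p IH].
by rewrite addSn => /CkS.
Qed.

Lemma Ck_derivable k f x i : Ck k.+1 f -> derivable f x (delta_mx 0 i).
Proof. by case=> _ /(_ i)[+ _]; apply. Qed.

Lemma Ck_partial k f i : Ck k.+1 f -> Ck k (partial i f).
Proof. by case=> _ /(_ i)[]. Qed.

Lemma partial_cst (a : R) i :
  partial i (fun _ : 'rV[R]_n => a) = (fun=> 0).
Proof. by apply/funext => x; exact: partial_val. Qed.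

Lemma Ck_cst k (a : R) : Ck k (fun _ : 'rV[R]_n => a).
Proof.
elim: k a => [|k IH] a; first exact: cst_continuous.
split; first exact: cst_continuous.
move=> i; split; first by move=> x; exact: derivable_cst.
by rewrite partial_cst; exact: IH.
Qed.

Lemma partialD f g i : (forall x, derivable f x (delta_mx 0 i)) ->
  (forall x, derivable g x (delta_mx 0 i)) ->
  partial i (fun x => f x + g x) = fun x => partial i f x + partial i g x.
Proof. by move=> df dg; apply/funext => x; exact: deriveD. Qed.

Lemma partialN f i : (forall x, derivable f x (delta_mx 0 i)) ->
  partial i (fun x => - f x) = fun x => - partial i f x.
Proof. by move=> df; apply/funext => x; exact: deriveN. Qed.

Lemma CkD k f g : Ck k f -> Ck k g -> Ck k (fun x => f x + g x).
Proof.
elim: k f g => [|k IH] f g.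
  by move=> cf cg x; exact: (continuousD (cf x) (cg x)).
move=> [cf df] [cg dg]; split.
  by move=> x; exact: (continuousD (cf x) (cg x)).
move=> i; have [dfi cfi] := df i; have [dgi cgi] := dg i; split.
  by move=> x; exact: derivableD.
by rewrite (partialD dfi dgi); exact: IH.
Qed.

Lemma CkN k f : Ck k f -> Ck k (fun x => - f x).
Proof.
elim: k f => [|k IH] f; first by move=> cf x; exact: (continuousN (cf x)).
move=> [cf df]; split; first by move=> x; exact: (continuousN (cf x)).
move=> i; have [dfi cfi] := df i; split; first by move=> x; exact: derivableN.
by rewrite (partialN dfi); exact: IH.
Qed.

Lemma Ck_sum k p (F : 'I_p -> 'rV[R]_n -> R) :
  (forall i, Ck k (F i)) -> Ck k (fun x => \sum_i F i x).
Proof.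
elim: p F => [|p IH] F cF.
  by under eq_fun do rewrite big_ord0; exact: Ck_cst.
under eq_fun do rewrite big_ord_recl.
by apply: CkD => //; exact: IH.
Qed.

Lemma partial_sum p (F : 'I_p -> 'rV[R]_n -> R) i : (forall j, Ck 1 (F j)) ->
  partial i (fun x => \sum_j F j x) = fun x => \sum_j partial i (F j) x.
Proof.
elim: p F => [|p IH] F cF.
  under eq_fun do rewrite big_ord0.
  by rewrite partial_cst; apply/funext => x; rewrite big_ord0.
under eq_fun do rewrite big_ord_recl.
rewrite partialD; [|by move=> x; exact: Ck_derivable (cF _)|].
  by rewrite IH//; apply/funext => x; rewrite big_ord_recl.
by move=> x; apply: (@Ck_derivable 0); exact: Ck_sum.
Qed.

Lemma Ck_laplacian k f : Ck k.+2 f -> Ck k (laplacian f).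
Proof. by move=> cf; apply: Ck_sum => i; do 2!apply: Ck_partial. Qed.

Lemma partialM f g i : (forall x, derivable f x (delta_mx 0 i)) ->
  (forall x, derivable g x (delta_mx 0 i)) ->
  partial i (fun x => f x * g x) =
  fun x => partial i f x * g x + f x * partial i g x.
Proof.
move=> df dg; apply/funext => x; rewrite /partial (deriveM (df x) (dg x)).
by rewrite addrC /GRing.scale /= mulrC.
Qed.

Lemma Ck1M f g : Ck 1 f -> Ck 1 g -> Ck 1 (fun x => f x * g x).
Proof.
move=> [cf df] [cg dg]; split.
  by move=> x; exact: (continuousM (cf x) (cg x)).
move=> i; have [dfi cfi] := df i; have [dgi cgi] := dg i; split.
  by move=> x; exact: derivableM.
rewrite (partialM dfi dgi) => x.
exact: (continuousD (continuousM (cfi x) (cg x)) (continuousM (cf x) (cgi x))).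
Qed.


Lemma coord_le_norm x i : `|x 0 i| <= `|x|.
Proof.
rewrite [`|x|]mx_normrE.
exact: (le_bigmax (0:R) (fun ij : 'I_1 * 'I_n => `|x ij.1 ij.2|) (0, i)).
Qed.

Lemma norm_le x (a : R) : 0 <= a -> (forall i, `|x 0 i| <= a) -> `|x| <= a.
Proof.
move=> a0 xa; rewrite [`|x|]mx_normrE; apply/bigmax_leP; split=> // -[j i] _.
by rewrite /= ord1.
Qed.

Lemma norm_delta_le i : `|delta_mx 0 i : 'rV[R]_n| <= 1.
Proof.
apply: norm_le => // j; rewrite mxE.
by case: (_ && _); rewrite ?normr1 ?normr0.
Qed.

(** The mean value theorem, applied first in direction i to the increment in
    direction j and then in direction j. *)
Lemma second_difference f i j x (h : R) : Ck 2 f -> 0 < h ->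
  exists c d, [/\ 0 < c < h, 0 < d < h &
    f (x + h *: delta_mx 0 j + h *: delta_mx 0 i) - f (x + h *: delta_mx 0 j)
    - f (x + h *: delta_mx 0 i) + f x =
    h ^+ 2 *
      partial j (partial i f) (x + c *: delta_mx 0 i + d *: delta_mx 0 j)].
Proof.
move=> cf h0.
pose F (s : R) := f (x + h *: delta_mx 0 j + s *: delta_mx 0 i).
pose G (s : R) := f (x + s *: delta_mx 0 i).
pose dF (s : R) := partial i f (x + h *: delta_mx 0 j + s *: delta_mx 0 i).
pose dG (s : R) := partial i f (x + s *: delta_mx 0 i).
have dFG s : is_derive s 1 (F - G) (dF s - dG s).
  apply: is_deriveB; apply/is_derive_line/is_derive_partial;
  exact: Ck_derivable cf.
have [c c0h Ec] := mean_value h0 (fun s _ => dFG s).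
pose H (t : R) := partial i f (x + c *: delta_mx 0 i + t *: delta_mx 0 j).
have dH t : is_derive t 1 H
    (partial j (partial i f) (x + c *: delta_mx 0 i + t *: delta_mx 0 j)).
  apply/is_derive_line/is_derive_partial.
  by apply: (@Ck_derivable 0); exact: Ck_partial cf.
have [d d0h Ed] := mean_value h0 (fun s _ => dH s).
exists c, d; split => //.
transitivity ((F - G) h - (F - G) 0).
  by rewrite /F /G !fctE !scale0r !addr0; ring.
rewrite Ec.
have -> : dF c - dG c = H h - H 0.
  by rewrite /dF /dG /H scale0r addr0 addrAC.
by rewrite Ed subr0 mulrAC -mulrA mulrC expr2.
Qed.

(** Schwarz's theorem: both mixed derivatives are limits of the same second
    difference quotient, which is symmetric in the two directions. *)
Lemma partialC f i j :
  Ck 2 f -> partial i (partial j f) = partial j (partial i f).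
Proof.
move=> cf; apply/funext => x; apply/eqP; rewrite -subr_eq0 -normr_le0.
apply/ler_addgt0Pl => /= e e0; rewrite addr0.
have e20 : 0 < e / 2 by rewrite divr_gt0.
have ci : {for x, continuous (partial i (partial j f))}.
  by apply: (@Ck_continuous 0); do 2 apply: Ck_partial.
have cj : {for x, continuous (partial j (partial i f))}.
  by apply: (@Ck_continuous 0); do 2 apply: Ck_partial.
have /cvgrPdist_lt /(_ _ e20) /nbhs_normP[a /= a0 Ha] := ci.
have /cvgrPdist_lt /(_ _ e20) /nbhs_normP[b /= b0 Hb] := cj.
pose h := Num.min a b / 2.
have h0 : 0 < h by rewrite divr_gt0// lt_min a0.
have box (c d : R) k l : 0 < c < h -> 0 < d < h ->
    `|x - (x + c *: delta_mx 0 k + d *: delta_mx 0 l)| < Num.min a b.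
  move=> /andP[c0 ch] /andP[d0 dh]; rewrite opprD addrA opprD addNKr.
  rewrite (_ : Num.min a b = h + h); last by rewrite /h -splitr.
  apply: le_lt_trans (ler_normB _ _) _; rewrite normrN !normrZ !gtr0_norm//.
  by apply: ltrD; [apply: le_lt_trans ch|apply: le_lt_trans dh];
    rewrite ger_pMr// norm_delta_le.
have [c [d [ch dh E1]]] := second_difference i j x cf h0.
have [c' [d' [ch' dh' E2]]] := second_difference j i x cf h0.
have := box _ _ i j ch dh; rewrite lt_min => /andP[_ /Hb/=].
have := box _ _ j i ch' dh'; rewrite lt_min => /andP[/Ha/= + _].
move: E1 E2; move: (partial j (partial i f) (x + _ + _)) => A.
move: (partial i (partial j f) (x + _ + _)) => B E1 E2.
have -> : A = B.
  apply: (@mulfI _ (h ^+ 2)); first by rewrite expf_neq0// gt_eqF.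
  apply: etrans (esym E1) _; apply: etrans _ E2.
  rewrite (addrAC x); congr (_ + _).
  exact: addrAC.
move=> /ltW xB /ltW Bx; rewrite -(subrKA B) (le_trans (ler_normD _ _))//.
rewrite [leRHS]splitr; apply: lerD; first exact: xB.
rewrite distrC; exact: Bx.
Qed.

End directional_calculus.

(** * Integration of continuous functions with compact support *)

Definition row_of (R : realType) (n : nat)
  (t : n.-tuple (measurableTypeR R)) : 'rV[R]_n := \row_i tnth t i.

Definition compactly_supported (R : realType) (n : nat) (f : 'rV[R]_n -> R) :=
  exists M : R, forall x, M < `|x| -> f x = 0.

(** A continuous function is the pointwise limit of its compositions with the
    rounding to the lattice (Z / (k + 1)) ^ n, which take countably many values,
    each on a union of boxes. *)
Lemma measurable_continuous_row (R : realType) (n : nat) (f : 'rV[R]_n -> R) :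
  continuous f ->
  measurable_fun setT (fun t : n.-tuple (measurableTypeR R) => f (row_of t)).
Proof.
move=> cf.
pose s (k : nat) (z : {ffun 'I_n -> int}) : 'rV[R]_n :=
  \row_i ((z i)%:~R / k.+1%:R).
pose r (k : nat) (t : n.-tuple (measurableTypeR R)) : {ffun 'I_n -> int} :=
  [ffun i => Num.floor (k.+1%:R * (tnth t i : R))].
pose cell (k : nat) (z : {ffun 'I_n -> int}) i : set (measurableTypeR R) :=
  [set x | Num.floor (k.+1%:R * (x : R)) = z i].
apply: (@measurable_fun_cvg _ _ _ _ (fun k t => f (s k (r k t)))).
  move=> k _ B mB; rewrite setTI.
  have -> : (fun t => f (s k (r k t))) @^-1` B =
      \bigcup_(z in (setT : set {ffun 'I_n -> int}))
        (if f (s k z) \in B then [set t | forall i, cell k z i (tnth t i)]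
         else set0).
    apply/seteqP; split=> [t /= Bt|t [z _]].
      by exists (r k t) => //; rewrite mem_set//= => i; rewrite /cell/= ffunE.
    case: ifPn => // /[1!inE] Bz /= tz; suff -> : r k t = z by [].
    by apply/ffunP => i; rewrite ffunE; exact: tz.
  apply: countable_bigcupT_measurable => // z; case: ifPn => // _.
  apply: (@measurable_tbox _ _ (cell k z)) => i.
  have -> : cell k z i =
     `[(z i)%:~R / k.+1%:R, (z i + 1)%:~R / k.+1%:R[%classic.
    apply/seteqP; split=> x /=; rewrite in_itv/=.
      move=> <-; rewrite ler_pdivrMr// ltr_pdivlMr// [x * _]mulrC.
      by rewrite floor_le floorD1_gt.
    move=> /andP[]; rewrite ler_pdivrMr// ltr_pdivlMr// [x * _]mulrC => a b.
    by apply/floor_def; rewrite a.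
  exact: measurable_itv.
move=> t _; apply: continuous_cvg; first exact: cf.
apply/cvgrPdist_le => e e0.
near=> k; apply: norm_le; first exact: ltW.
move=> i; rewrite !mxE ffunE.
have /andP[a b] := floor_itv (k.+1%:R * (tnth t i : R)).
have ke : k.+1%:R^-1 < e by near: k; exact: (near_infty_natSinv_lt (PosNum e0)).
rewrite ger0_norm; last by rewrite subr_ge0 ler_pdivrMr// [leRHS]mulrC.
apply: le_trans (ltW ke); rewrite lerBlDr -[X in X + _]mul1r -mulrDl.
by rewrite ler_pdivlMr// [leLHS]mulrC addrC -intrD1 ltW.
Unshelve. all: by end_near. Qed.

Section integration.
Context {R : realType} {n : nat}.
Implicit Types f g : 'rV[R]_n -> R.

Lemma compactly_supported_bounded f : continuous f -> compactly_supported f ->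
  exists2 C : R, 0 <= C & forall x, `|f x| <= C.
Proof.
move=> cf [M fM].
have /compact_bounded[C [_ fC]] : compact (f @` [set x : 'rV[R]_n |
    forall i, `[- M, M]%classic (x 0 i)]).
  apply: continuous_compact; first exact: continuous_subspaceT.
  by apply: (@rV_compact _ _ (fun=> `[- M, M]%classic)) => i;
    exact: segment_compact.
exists (`|C| + 1); first by rewrite addr_ge0.
move=> x; have [Mx|xM] := ltP M `|x|; first by rewrite fM// normr0 addr_ge0.
apply: fC; first by rewrite (le_lt_trans (ler_norm C)) ?ltrDl.
exists x => //= i; rewrite in_itv/= -ler_norml.
exact: le_trans (coord_le_norm _ _) xM.
Qed.

Lemma integrable_row f : continuous f -> compactly_supported f ->
  (lebesgueRn R n).-integrable setT
    (EFin \o (fun t : n.-tuple (measurableTypeR R) => f (row_of t))).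
Proof.
move=> cf sf; have [C C0 fC] := compactly_supported_bounded cf sf.
have [M fM] := sf.
pose A (i : 'I_n) : set (measurableTypeR R) := `[- M, M]%classic.
pose B := [set t : n.-tuple (measurableTypeR R) | forall i, A i (tnth t i)].
have mB : measurable B by apply: measurable_tbox => i; exact: measurable_itv.
have Boo : (lebesgueRn R n B < +oo)%E.
  rewrite lebesgueRn_box; last by move=> i; exact: measurable_itv.
  rewrite ltey_eq prode_fin_num// => i _.
  by rewrite lebesgue_measure_itv; case: ifP.
have Bf : (lebesgueRn R n).-integrable B
    (EFin \o (fun t : n.-tuple (measurableTypeR R) => f (row_of t))).
  apply: measurable_bounded_integrable => //.
    by apply: measurable_funTS; exact: measurable_continuous_row.
  exists C; split; first exact: num_real.
  by move=> D CD t _; exact: le_trans (fC _) (ltW CD).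
have /(integrable_mkcond _ mB) := Bf; apply: eq_integrable => // t _.
rewrite patchE; case: ifPn => // tB; congr EFin; apply/esym/fM.
rewrite ltNge; apply: contra tB => tM; rewrite inE => i; rewrite /A/= in_itv/=.
by rewrite -ler_norml (le_trans _ tM)// -[leRHS]/(`|_|)
  (le_trans _ (coord_le_norm _ i))// mxE.
Qed.

Definition Cc f := continuous f /\ compactly_supported f.

Lemma intRnD f g : Cc f -> Cc g ->
  intRn (fun x => f x + g x) = intRn f + intRn g.
Proof.
by move=> [cf sf] [cg sg]; apply: RintegralD => //; exact: integrable_row.
Qed.

Lemma intRnB f g : Cc f -> Cc g ->
  intRn (fun x => f x - g x) = intRn f - intRn g.
Proof.
by move=> [cf sf] [cg sg]; apply: RintegralB => //; exact: integrable_row.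
Qed.

Lemma intRnZ a f : Cc f -> intRn (fun x => a * f x) = a * intRn f.
Proof. by move=> [cf sf]; apply: RintegralZl => //; exact: integrable_row. Qed.

Lemma intRn0 : intRn (fun _ : 'rV[R]_n => 0) = 0.
Proof. by rewrite /intRn Rintegral_cst// mul0r. Qed.

Lemma le_intRn f g : Cc f -> Cc g -> (forall x, f x <= g x) ->
  intRn f <= intRn g.
Proof.
by move=> [cf sf] [cg sg] fg; apply: le_Rintegral => //; exact: integrable_row.
Qed.

Lemma CcD f g : Cc f -> Cc g -> Cc (fun x => f x + g x).
Proof.
move=> [cf [a fa]] [cg [b gb]]; split.
  by move=> x; exact: (continuousD (cf x) (cg x)).
exists (Num.max a b) => x; rewrite gt_max => /andP[ax bx].
by rewrite fa// gb// addr0.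
Qed.

Lemma CcB f g : Cc f -> Cc g -> Cc (fun x => f x - g x).
Proof.
move=> [cf [a fa]] [cg [b gb]]; split.
  by move=> x; exact: (continuousB (cf x) (cg x)).
exists (Num.max a b) => x; rewrite gt_max => /andP[ax bx].
by rewrite fa// gb// subr0.
Qed.

Lemma CcMl f g : continuous f -> Cc g -> Cc (fun x => f x * g x).
Proof.
move=> cf [cg [b gb]]; split.
  by move=> x; exact: (continuousM (cf x) (cg x)).
by exists b => x bx; rewrite gb// mulr0.
Qed.

Lemma Cc0 : Cc (fun _ : 'rV[R]_n => 0).
Proof. by split; [exact: cst_continuous|exists 0]. Qed.

Lemma Cc_sum p (F : 'I_p -> 'rV[R]_n -> R) : (forall i, Cc (F i)) ->
  Cc (fun x => \sum_i F i x).
Proof.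
elim: p F => [|p IH] F CF.
  by under eq_fun do rewrite big_ord0; exact: Cc0.
under eq_fun do rewrite big_ord_recl.
by apply: CcD => //; exact: IH.
Qed.

Lemma intRn_sum p (F : 'I_p -> 'rV[R]_n -> R) : (forall i, Cc (F i)) ->
  intRn (fun x => \sum_i F i x) = \sum_i intRn (F i).
Proof.
elim: p F => [|p IH] F CF.
  by under eq_fun do rewrite big_ord0; rewrite intRn0 big_ord0.
under eq_fun do rewrite big_ord_recl.
by rewrite intRnD ?IH ?big_ord_recl//; exact: Cc_sum.
Qed.

End integration.

(** * Fubini and integration by parts *)

Section vanishing.
Context {R : realType} {V : normedModType R}.
Implicit Types (f : V -> R) (x v : V).

Lemma is_derive_near0 f x v d :
  (\forall y \near x, f y = 0) -> is_derive x v f d -> d = 0.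
Proof.
move=> f0 [_ <-]; rewrite (@near_eq_derive _ _ _ f (cst 0) x v f0).
exact: derive_cst.
Qed.

Lemma is_derive_far0 f x v d (M : R) : M < `|x| ->
  (forall y, M < `|y| -> f y = 0) -> is_derive x v f d -> d = 0.
Proof.
move=> Mx f0; apply: is_derive_near0.
near=> y; apply: f0; near: y.
exact: (@cvgr_norm_gt _ _ _ (nbhs x) _ id x cvg_id M Mx).
Unshelve. all: by end_near. Qed.

Lemma is_derive_ball0 f x v d (r : R) : `|x| < r ->
  (forall y, `|y| < r -> f y = 0) -> is_derive x v f d -> d = 0.
Proof.
move=> xr f0; apply: is_derive_near0.
near=> y; apply: f0; near: y.
exact: (@cvgr_norm_lt _ _ _ (nbhs x) _ id x cvg_id r xr).
Unshelve. all: by end_near. Qed.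

End vanishing.

Lemma integral_derive_eq0 (R : realType) (f df : R -> R) (M : R) :
  (forall s : R, is_derive s 1 f (df s)) -> continuous df ->
  (forall s, M < `|s| -> f s = 0) ->
  (\int[@lebesgue_measure R]_s (df s)%:E = 0)%E.
Proof.
move=> fdf cdf f0.
pose a : R := `|M| + 1.
pose I : set R := `[- a, a]%classic.
have a0 : 0 < a by rewrite /a ltr_pwDr.
have Ma (s : R) : a <= `|s| -> M < `|s|.
  by apply: lt_le_trans; rewrite /a (le_lt_trans (ler_norm M))// ltrDl.
have df0 (s : R) : a <= `|s| -> df s = 0.
  by move=> /Ma Ms; exact: (is_derive_far0 Ms f0 (fdf s)).
have cf : continuous f.
  move=> s; apply: differentiable_continuous; apply/derivable1_diffP.
  by case: (fdf s).
have -> : (\int[@lebesgue_measure R]_s (df s)%:E =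
           \int[@lebesgue_measure R]_(s in I) (df s)%:E)%E.
  rewrite [RHS]integral_mkcond; apply: eq_integral => s _.
  rewrite patchE; case: ifPn => // /negP sa; rewrite df0// leNgt.
  apply/negP => /ltW; rewrite ler_norml => sM; apply: sa.
  by rewrite inE /I /= in_itv.
rewrite (@continuous_FTC2 _ df f (- a) a).
- by rewrite (f0 a) ?(f0 (- a)) ?subee//; apply: Ma; rewrite ?normrN gtr0_norm.
- by rewrite gtrN.
- exact: continuous_subspaceT.
- split.
  + by move=> s _; case: (fdf s).
  + by apply: cvg_at_right_filter; exact: cf.
  + by apply: cvg_at_left_filter; exact: cf.
- by move=> s _; rewrite derive1E; case: (fdf s).
Qed.

Section fubini.
Context {R : realType} {n : nat}.

Definition cons_row (x : R) (y : 'rV[R]_n) : 'rV[R]_n.+1 :=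
  \row_i oapp (fun j => y 0 j) x (unlift ord0 i).

Lemma cons_row_of (x : R) (t : n.-tuple (measurableTypeR R)) :
  row_of (tcons (x, t)) = cons_row x (row_of t).
Proof.
apply/rowP => i; rewrite !mxE; case: unliftP => [j|] ->.
  by rewrite tnthS/= mxE.
by rewrite tnth0.
Qed.

Lemma norm_cons_row_ge (x : R) (y : 'rV[R]_n) :
  `|x| <= `|cons_row x y| /\ `|y| <= `|cons_row x y|.
Proof.
split.
  have := coord_le_norm (cons_row x y) ord0; rewrite mxE.
  by case: unliftP => [j /eqP|].
apply: norm_le => // j.
have := coord_le_norm (cons_row x y) (lift ord0 j); rewrite mxE.
by rewrite liftK.
Qed.

Lemma norm_cons_row_le (x : R) (y : 'rV[R]_n) (e : R) : 0 <= e ->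
  `|x| <= e -> `|y| <= e -> `|cons_row x y| <= e.
Proof.
move=> e0 xe ye; apply: norm_le => // i; rewrite mxE.
by case: unliftP => //= j _; exact: le_trans (coord_le_norm _ _) ye.
Qed.

Lemma cons_rowB x y x' y' :
  cons_row x y - cons_row x' y' = cons_row (x - x') (y - y').
Proof.
by apply/rowP => i; rewrite !mxE; case: unliftP => //= j _; rewrite !mxE.
Qed.

Lemma continuous_cons_row_r x : continuous (cons_row x).
Proof.
move=> y; apply/(@cvgrPdist_le _ _ _ (nbhs y)) => e e0; near=> z.
rewrite cons_rowB subrr; apply: norm_cons_row_le;
  [exact: ltW|by rewrite normr0 ltW|].
by near: z; exact: (@cvgr_dist_le _ _ _ (nbhs y) _ id y cvg_id e e0).
Unshelve. all: by end_near. Qed.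

Lemma cons_row_line (x s : R) (y : 'rV[R]_n) :
  cons_row (x + s) y = cons_row x y + s *: delta_mx 0 ord0.
Proof.
apply/rowP => i; rewrite !mxE; case: unliftP => [j|] -> /=.
  by rewrite mulr0 addr0.
by rewrite mulr1.
Qed.

Lemma cons_row_liner (x s : R) (y : 'rV[R]_n) j :
  cons_row x (y + s *: delta_mx 0 j) =
  cons_row x y + s *: delta_mx 0 (lift ord0 j).
Proof.
apply/rowP => i; rewrite !mxE; case: unliftP => [k|] -> /=.
  by rewrite !mxE (inj_eq lift_inj).
by rewrite mulr0 addr0.
Qed.

Variable f : 'rV[R]_n.+1 -> R.
Hypotheses (cf : continuous f) (sf : compactly_supported f).

Lemma Cc_cons_row x : Cc (fun y => f (cons_row x y)).
Proof.
split.
  by move=> y; apply: continuous_comp; [exact: continuous_cons_row_r|exact: cf].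
have [M fM] := sf; exists M => y My; apply: fM.
exact: lt_le_trans My (norm_cons_row_ge x y).2.
Qed.

Let F := EFin \o (fun t : n.+1.-tuple (measurableTypeR R) => f (row_of t)).

Let mF : measurable_fun setT F.
Proof. by apply/measurable_EFinP; exact: measurable_continuous_row. Qed.

Let iF : ((@lebesgue_measure R) \x (lebesgueRn R n))%E.-integrable setT
  (F \o tcons).
Proof.
have /integrableP[_ Foo] := integrable_row cf sf.
apply/integrableP; split.
  by apply: measurableT_comp => //; exact: measurable_tcons.
move: Foo; rewrite [X in (integral X _ _ < _)%E -> _](_ : _ =
  pushforward ((@lebesgue_measure R) \x (lebesgueRn R n))%E tcons)//.
rewrite ge0_integral_pushforward//.
- exact: measurable_tcons.
- by apply: measurableT_comp.
Qed.

Lemma intRn_fubini : intRn f =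
  fine (\int[((@lebesgue_measure R) \x (lebesgueRn R n))%E]_z (F \o tcons) z)%E.
Proof.
rewrite /intRn /Rintegral; congr fine.
pose lebesgue_prod := ((@lebesgue_measure R) \x (lebesgueRn R n))%E.
transitivity (\int[pushforward lebesgue_prod tcons]_z F z)%E; first by [].
by rewrite integral_pushforward//; exact: measurable_tcons.
Qed.

Lemma intRn_eq0_tail : (forall x, intRn (fun y => f (cons_row x y)) = 0) ->
  intRn f = 0.
Proof.
move=> f0; rewrite intRn_fubini -integral12_prod_meas1// integral0_eq//.
move=> x _; have [cfx sfx] := Cc_cons_row x.
transitivity (\int[lebesgueRn R n]_t (f (cons_row x (row_of t)))%:E)%E.
  by apply: eq_integral => t _; rewrite -cons_row_of.
rewrite -[LHS]fineK; last exact: integrable_fin_num (integrable_row cfx sfx).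
rewrite -[RHS]/((0:R)%:E); congr EFin; exact: (f0 x).
Qed.

Lemma intRn_eq0_head :
  (forall y, \int[@lebesgue_measure R]_x (f (cons_row x y))%:E = 0)%E ->
  intRn f = 0.
Proof.
move=> f0; rewrite intRn_fubini -integral21_prod_meas1// integral0_eq//.
move=> t _; rewrite /fubini_G -[RHS](f0 (row_of t)).
by apply: eq_integral => x _; rewrite -cons_row_of.
Qed.

End fubini.

Lemma compactly_supported_partial (R : realType) (n : nat) (i : 'I_n)
  (f : 'rV[R]_n -> R) : (forall x, derivable f x (delta_mx 0 i)) ->
  compactly_supported f -> compactly_supported (partial i f).
Proof.
move=> df [M fM]; exists M => x Mx.
exact: (is_derive_far0 Mx fM (is_derive_partial (df x))).
Qed.

(** Peeling off coordinates by Fubini's theorem leaves an integral over the i-th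
    coordinate alone, which vanishes by the fundamental theorem of calculus. *)
Lemma intRn_partial_eq0 (R : realType) (n : nat) (i : 'I_n)
    (f : 'rV[R]_n -> R) :
  (forall x, derivable f x (delta_mx 0 i)) -> continuous (partial i f) ->
  Cc f -> intRn (partial i f) = 0.
Proof.
elim: n i f => [[]//|n IH] i f /= ddf cdf [cf sf].
have df x := is_derive_partial (ddf x).
have sdf := compactly_supported_partial ddf sf.
case: (unliftP ord0 i) => [j|] ij; rewrite ij in df cdf sdf *.
  apply: intRn_eq0_tail => // x.
  have E y : is_derive y (delta_mx 0 j) (fun y => f (cons_row x y))
                (partial (lift ord0 j) f (cons_row x y)).
    apply/is_derive_line0; have /is_derive_line0 := df (cons_row x y).
    by under eq_fun do rewrite -cons_row_liner.
  have Ep : (fun y => partial (lift ord0 j) f (cons_row x y)) =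
            partial j (fun y => f (cons_row x y)).
    by apply/funext => y; apply/esym; exact: partial_val.
  rewrite Ep; apply: IH; last exact: Cc_cons_row.
    by move=> y; case: (E y).
  by rewrite -Ep; exact: (Cc_cons_row cdf sdf x).1.
have line s y : cons_row s y = cons_row 0 y + s *: delta_mx 0 ord0.
  by rewrite -cons_row_line add0r.
apply: intRn_eq0_head => // y; have [M fM] := sf.
apply: (@integral_derive_eq0 _ (fun s => f (cons_row s y)) _ M).
- move=> s; under eq_fun do rewrite line.
  by apply/is_derive_line; rewrite -line.
- under eq_fun do rewrite line.
  exact: continuous_line.
- by move=> s Ms; apply: fM; exact: lt_le_trans Ms (norm_cons_row_ge s y).1.
Qed.

Section integration_by_parts.
Context {R : realType} {n : nat}.
Implicit Types f g : 'rV[R]_n -> R.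

Lemma intRn_by_parts i f g : Ck 1 f -> Ck 1 g -> compactly_supported g ->
  intRn (fun x => partial i f x * g x) = - intRn (fun x => f x * partial i g x).
Proof.
move=> Cf Cg sg.
have df x : derivable f x (delta_mx 0 i) by exact: Ck_derivable Cf.
have dg x : derivable g x (delta_mx 0 i) by exact: Ck_derivable Cg.
have cdf : continuous (partial i f).
  by apply: (@Ck_continuous _ _ 0); exact: Ck_partial.
have cdg : continuous (partial i g).
  by apply: (@Ck_continuous _ _ 0); exact: Ck_partial.
have Ccg : Cc g by split=> //; exact: Ck_continuous Cg.
have Ccdg : Cc (partial i g) by split=> //; exact: compactly_supported_partial.
have cf := Ck_continuous Cf.
have fg : Cc (fun x => f x * g x) by exact: CcMl.
have Cfg := Ck1M Cf Cg.
have := @intRn_partial_eq0 _ _ i _ (fun x => Ck_derivable Cfg)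
  (Ck_continuous (Ck_partial i Cfg)) fg.
rewrite (partialM df dg) intRnD; [|exact: CcMl|exact: CcMl].
by move/eqP; rewrite addr_eq0 => /eqP.
Qed.

End integration_by_parts.

(** * Energies of all orders *)

Section energy.
Context {R : realType} {n : nat}.
Implicit Types f g : 'rV[R]_n -> R.

Definition Ccsmooth f := Csmooth f /\ compactly_supported f.

Lemma Csmooth_partial i f : Csmooth f -> Csmooth (partial i f).
Proof. by move=> Cf k; exact: Ck_partial. Qed.

Lemma Ccsmooth_partial i f : Ccsmooth f -> Ccsmooth (partial i f).
Proof.
move=> [Cf sf]; split; first exact: Csmooth_partial.
by apply: compactly_supported_partial => // x; exact: Ck_derivable (Cf 1%N).
Qed.

Lemma Ccsmooth_Cc f : Ccsmooth f -> Cc f.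
Proof. by move=> [Cf sf]; split=> //; exact: Ck_continuous (Cf 0%N). Qed.

Lemma compactly_supported_sum p (F : 'I_p -> 'rV[R]_n -> R) :
  (forall i, Cc (F i)) -> compactly_supported (fun x => \sum_i F i x).
Proof. by move=> CF; case: (Cc_sum CF). Qed.

Lemma Ccsmooth_laplacian f : Ccsmooth f -> Ccsmooth (laplacian f).
Proof.
move=> tf; split; first by move=> k; exact: Ck_laplacian (tf.1 _).
apply: compactly_supported_sum => i; apply: Ccsmooth_Cc.
by do 2!apply: Ccsmooth_partial.
Qed.

Lemma Ccsmooth_CcM f g : Ccsmooth f -> Ccsmooth g -> Cc (fun x => f x * g x).
Proof. by move=> /Ccsmooth_Cc[cf _] /Ccsmooth_Cc Cg; exact: CcMl. Qed.

Lemma partial_laplacian i f : Csmooth f ->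
  partial i (laplacian f) = laplacian (partial i f).
Proof.
move=> Cf; rewrite /laplacian partial_sum; last first.
  by move=> j; do 2!apply: Ck_partial; exact: (Cf 3%N).
apply/funext => x; apply: eq_bigr => j _.
by rewrite partialC ?(partialC i j (Cf 2%N))//; exact: Csmooth_partial.
Qed.

(** The sum of the squared L^2 norms of the j-th order partial derivatives,
    mixed derivatives being counted once for every order of differentiation:
    with this count the sum is expressed by iterated Laplacians. *)
Fixpoint energy (j : nat) f : R :=
  match j with
  | 0 => intRn (fun x => f x ^+ 2)
  | j'.+1 => \sum_i energy j' (partial i f)
  end.

(** Both integrals equal minus that of the product of the i-th first derivative
    and the third derivative in the directions i, j, j. *)
Lemma intRn_hessian i j f : Ccsmooth f ->
  intRn (fun x => partial j (partial i f) x ^+ 2) =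
  intRn (fun x => partial i (partial i f) x * partial j (partial j f) x).
Proof.
move=> tf; have C1 g : Ccsmooth g -> Ck 1 g by move=> tg; exact: (tg.1 1%N).
have ti := Ccsmooth_partial i tf; have tji := Ccsmooth_partial j ti.
have tjj := Ccsmooth_partial j (Ccsmooth_partial j tf).
transitivity (- intRn (fun x =>
    partial i f x * partial j (partial j (partial i f)) x)).
  exact: (intRn_by_parts j (C1 _ ti) (C1 _ tji) tji.2).
apply: etrans _ (esym (intRn_by_parts i (C1 _ ti) (C1 _ tjj) tjj.2)).
rewrite (partialC j i (tf.1 2%N)).
by rewrite (partialC j i ((Ccsmooth_partial j tf).1 2%N)).
Qed.

(** Summing intRn_hessian over i and j shows that the Hessian and the Laplacian
    have the same L^2 norm; the higher orders follow because the Laplacian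
    commutes with partial derivatives. *)
Lemma energy_laplacian j f : Ccsmooth f ->
  energy j.+2 f = energy j (laplacian f).
Proof.
elim: j f => [|j IH] f tf; last first.
  transitivity (\sum_i energy j.+2 (partial i f)); first by [].
  rewrite [RHS]/=; apply: eq_bigr => i _.
  by rewrite (IH _ (Ccsmooth_partial i tf)) partial_laplacian//; exact: tf.1.
rewrite /=; under eq_bigr do under eq_bigr do rewrite intRn_hessian//.
have t2 i := Ccsmooth_partial i (Ccsmooth_partial i tf).
transitivity (intRn (fun x => \sum_i \sum_j
    partial i (partial i f) x * partial j (partial j f) x)).
  rewrite intRn_sum; last first.
    by move=> i; apply: Cc_sum => j; exact: Ccsmooth_CcM.
  apply: eq_bigr => i _; rewrite intRn_sum// => j; exact: Ccsmooth_CcM.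
congr intRn; apply/funext => x; rewrite expr2 /laplacian big_distrl/=.
by apply: eq_bigr => i _; rewrite big_distrr.
Qed.

Lemma energy_iter_laplacian k f : Ccsmooth f ->
  energy k.*2.+1 f = energy 1 (iter k laplacian f).
Proof.
elim: k f => [//|k IH] f tf.
rewrite doubleS energy_laplacian// IH; last exact: Ccsmooth_laplacian.
by rewrite -iterSr.
Qed.

Lemma Ccsmooth_iter_laplacian k f : Ccsmooth f -> Ccsmooth (iter k laplacian f).
Proof. by move=> tf; elim: k => //= k IH; exact: Ccsmooth_laplacian. Qed.

Lemma energy1E f : Ccsmooth f ->
  energy 1 f = intRn (fun x => enorm (grad f x) ^+ 2).
Proof.
move=> tf /=; rewrite -intRn_sum; last first.
  move=> i; have ti := Ccsmooth_partial i tf.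
  exact: (Ccsmooth_CcM ti ti).
congr intRn; apply/funext => x; rewrite sqr_sqrtr.
  by apply: eq_bigr => i _; rewrite mxE.
by apply: sumr_ge0 => i _; exact: sqr_ge0.
Qed.

End energy.

(** * A weighted Hardy inequality *)

Section hardy.
Context {R : realType} {n : nat}.
Implicit Types (f g : 'rV[R]_n -> R) (x : 'rV[R]_n).

Definition sqnorm x : R := \sum_i x 0 i ^+ 2.

(** Regularized at the origin, so that integration by parts meets no
    singularity, and rational in x, so that its derivatives are of the same
    form. *)
Definition weight (b : nat) x : R := (1 + sqnorm x)^-1 ^+ b.

Lemma sqnorm_ge0 x : 0 <= sqnorm x.
Proof. by apply: sumr_ge0 => i _; exact: sqr_ge0. Qed.

Lemma sqr_coord_le x i : x 0 i ^+ 2 <= sqnorm x.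
Proof.
rewrite /sqnorm (bigD1 i)//= lerDl; apply: sumr_ge0 => j _; exact: sqr_ge0.
Qed.

Lemma base_gt0 x : 0 < 1 + sqnorm x.
Proof. by rewrite ltr_pwDl// sqnorm_ge0. Qed.

Lemma weight_ge0 b x : 0 <= weight b x.
Proof. by rewrite exprn_ge0// invr_ge0 ltW// base_gt0. Qed.

Lemma weight_le1 b x : weight b x <= 1.
Proof.
rewrite exprn_ile1//; first by rewrite invr_ge0 ltW// base_gt0.
by rewrite invf_le1 ?base_gt0// lerDl sqnorm_ge0.
Qed.

Lemma weightS b x : weight b.+1 x = (1 + sqnorm x)^-1 * weight b x.
Proof. by rewrite /weight exprS. Qed.

Lemma weight_mulS b x : weight b x = (1 + sqnorm x) * weight b.+1 x.
Proof. by rewrite weightS mulrA divff ?mul1r// gt_eqF// base_gt0. Qed.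

Lemma partial_coord i k : partial i (fun x => x 0 k) = fun=> (k == i)%:R.
Proof.
apply/funext => x; rewrite (partial_val (is_derive_coord x _ k)) mxE.
by rewrite eqxx.
Qed.

Lemma Ck1_coord k : Ck 1 (fun x => x 0 k).
Proof.
split; first exact: coord_continuous.
move=> i; split; first by move=> x; case: (is_derive_coord x (delta_mx 0 i) k).
by rewrite partial_coord; exact: cst_continuous.
Qed.

Lemma Ck1_sqr f : Ck 1 f -> Ck 1 (fun x => f x ^+ 2).
Proof. by move=> Cf; exact: (Ck1M Cf Cf). Qed.

Lemma partial_sqr f i : Ck 1 f ->
  partial i (fun x => f x ^+ 2) = fun x => 2 * f x * partial i f x.
Proof.
move=> Cf; have df x : derivable f x (delta_mx 0 i) by exact: Ck_derivable Cf.
apply: etrans (partialM df df) _; apply/funext => x; ring.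
Qed.

Lemma Ck1_sqnorm : Ck 1 sqnorm.
Proof. by apply: Ck_sum => k; exact: Ck1_sqr (Ck1_coord k). Qed.

Lemma partial_sqnorm i : partial i sqnorm = fun x => 2 * x 0 i.
Proof.
rewrite (partial_sum i (fun k => Ck1_sqr (Ck1_coord k))); apply/funext => x.
rewrite (bigD1 i)//= big1; last first.
  move=> k ki; rewrite (partial_sqr i (Ck1_coord k)) partial_coord.
  by rewrite (negbTE ki) mulr0.
by rewrite addr0 (partial_sqr i (Ck1_coord i)) partial_coord eqxx mulr1.
Qed.

Lemma Ck1_base : Ck 1 (fun x => 1 + sqnorm x).
Proof. by apply: CkD; [exact: Ck_cst|exact: Ck1_sqnorm]. Qed.

Lemma partial_base i : partial i (fun x => 1 + sqnorm x) = fun x => 2 * x 0 i.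
Proof.
have C1 : Ck 1 (fun _ : 'rV[R]_n => 1 : R) by exact: Ck_cst.
rewrite (partialD (fun x => Ck_derivable C1)
                  (fun x => Ck_derivable Ck1_sqnorm)).
by rewrite partial_cst partial_sqnorm; apply/funext => x; rewrite add0r.
Qed.

Lemma is_derive_weight1 i x :
  is_derive x (delta_mx 0 i) (weight 1) (- (2 * x 0 i * weight 2 x)).
Proof.
have b0 : 1 + sqnorm x != 0 by rewrite gt_eqF// base_gt0.
have db : derivable (fun x => 1 + sqnorm x) x (delta_mx 0 i).
  exact: Ck_derivable Ck1_base.
have -> : weight 1 = fun x => (1 + sqnorm x)^-1.
  by apply/funext => y; rewrite /weight expr1.
split; first exact: (@derivableV _ _ (fun x => 1 + sqnorm x) x _ b0 db).
apply: etrans (@deriveV _ _ (fun x => 1 + sqnorm x) x _ b0 db) _.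
have -> : 'D_(delta_mx 0 i) (fun x => 1 + sqnorm x) x = 2 * x 0 i.
  by rewrite -[LHS]/(partial i _ x) partial_base.
by rewrite scaleNr /GRing.scale/= /weight -exprVn mulrC.
Qed.

Lemma continuous_weight b : continuous (weight b).
Proof.
move=> x; apply: (@continuous_comp _ _ _ (fun x => (1 + sqnorm x)^-1)
                                         (fun y => y ^+ b)).
  have b0 : 1 + sqnorm x != 0 by rewrite gt_eqF// base_gt0.
  have cb : {for x, continuous (fun x => 1 + sqnorm x)}.
    exact: (Ck_continuous Ck1_base).
  by have := @continuousV R 'rV[R]_n (fun x => 1 + sqnorm x) x b0 cb.
exact: exprn_continuous.
Qed.

Lemma weight_C1 b : Ck 1 (weight b) /\
  forall i, partial i (weight b) =
            fun x => - (2 * b%:R * x 0 i * weight b.+1 x).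
Proof.
have w1 : Ck 1 (weight 1).
  split; first exact: continuous_weight.
  move=> i; split; first by move=> x; case: (is_derive_weight1 i x).
  rewrite (_ : partial i _ = fun x => - (2 * x 0 i * weight 2 x)); last first.
    by apply/funext => x; exact: partial_val (is_derive_weight1 i x).
  apply: (@CkN _ _ 0); apply: continuous_mul; last exact: continuous_weight.
  by apply: continuous_mul; [exact: cst_continuous|exact: coord_continuous].
elim: b => [|b [Cb Eb]].
  have -> : weight 0 = fun=> 1 by [].
  split; first exact: Ck_cst.
  move=> i; rewrite partial_cst; apply/funext => x.
  by rewrite mulr0 !mul0r oppr0.
have E : weight b.+1 = fun x => weight 1 x * weight b x.
  by apply/funext => x; exact: weightS.
split; first by rewrite E; exact: Ck1M.
move=> i.
rewrite E (partialM (fun x => Ck_derivable w1) (fun x => Ck_derivable Cb)).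
apply/funext => x; rewrite Eb (partial_val (is_derive_weight1 i x)).
rewrite /weight -natr1 !exprS expr0; ring.
Qed.

(** With B = b + 1, the divergence of x (1 + |x|^2)^(-B) f^2 has zero integral.
    It is the sum of a cross term and of
    (n - 2 B |x|^2 / (1 + |x|^2)) (1 + |x|^2)^(-B) f^2, and where f does not
    vanish |x| >= 1, so that this factor is at most n - B <= -1: half of it
    absorbs the cross term. *)
Lemma weighted_hardy (b : nat) f : (0 < n)%N -> (n < b.+1)%N ->
  Ck 1 f -> compactly_supported f -> (forall x, `|x| < 1 -> f x = 0) ->
  intRn (fun x => weight b.+1 x * f x ^+ 2) <=
  4 * n%:R * \sum_i intRn (fun x => weight b x * partial i f x ^+ 2).
Proof.
move=> n0 nb Cf sf f0.
have [Cw dw] := weight_C1 b.+1.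
pose F i x := x 0 i * (weight b.+1 x * f x ^+ 2).
have Cwf : Ck 1 (fun x => weight b.+1 x * f x ^+ 2).
  exact: Ck1M Cw (Ck1_sqr Cf).
have CF i : Ck 1 (F i) by exact: Ck1M (Ck1_coord i) Cwf.
have CcF i : Cc (F i).
  split; first exact: Ck_continuous (CF i).
  by have [M fM] := sf; exists M => x /fM fx; rewrite /F fx expr0n /= !mulr0.
have CcdF i : Cc (partial i (F i)).
  split; first exact: Ck_continuous (Ck_partial i (CF i)).
  apply: compactly_supported_partial (CcF i).2 => x.
  exact: Ck_derivable (CF i).
have Ccwf : Cc (fun x => weight b.+1 x * f x ^+ 2).
  split; first exact: Ck_continuous Cwf.
  by have [M fM] := sf; exists M => x /fM fx; rewrite fx expr0n /= !mulr0.
have sdf i : compactly_supported (partial i f).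
  by apply: compactly_supported_partial sf => x; exact: Ck_derivable Cf.
have Ccwd i : Cc (fun x => weight b x * partial i f x ^+ 2).
  split; last first.
    by have [M fM] := sdf i; exists M => x /fM fx; rewrite fx expr0n /= !mulr0.
  have cd := Ck_continuous (Ck_partial i Cf).
  by apply: continuous_mul (@continuous_weight b) (continuous_mul cd cd).
have FE i x : partial i (F i) x = weight b.+1 x * f x ^+ 2
    - 2 * b.+1%:R * x 0 i ^+ 2 * weight b.+2 x * f x ^+ 2
    + 2 * x 0 i * weight b.+1 x * f x * partial i f x.
  rewrite /F (partialM (fun x => Ck_derivable (Ck1_coord i))
                       (fun x => Ck_derivable Cwf)).
  rewrite (partialM (fun x => Ck_derivable Cw)
                    (fun x => Ck_derivable (Ck1_sqr Cf))).
  rewrite partial_coord eqxx dw (partial_sqr i Cf) -[true%:R]/(1 : R); ring.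
have I0 : intRn (fun x => \sum_i partial i (F i) x) = 0.
  rewrite intRn_sum// big1// => i _.
  apply: intRn_partial_eq0 => //; last exact: (CcdF i).1.
  by move=> x; exact: Ck_derivable (CF i).
have nR : 0 < n%:R :> R by rewrite ltr0n.
have pointwise x : 2^-1 * (weight b.+1 x * f x ^+ 2) <=
    2 * n%:R * (\sum_i weight b x * partial i f x ^+ 2)
    - \sum_i partial i (F i) x.
  pose v := (1 + sqnorm x)^-1; pose c := weight b.+1 x * f x ^+ 2.
  have c0 : 0 <= c by rewrite mulr_ge0 ?weight_ge0 ?sqr_ge0.
  have termwise i : partial i (F i) x <= c * (1 + (2 * n%:R)^-1) +
      (- (2 * b.+1%:R * v * c) * x 0 i ^+ 2 +
       2 * n%:R * (weight b x * partial i f x ^+ 2)).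
    rewrite FE (weightS b.+1) -/v (weight_mulS b) /c.
    have w0 := weight_ge0 b.+1 x; have Xs := sqr_coord_le x i.
    have s0 := sqnorm_ge0 x.
    move: (weight b.+1 x) (f x) (partial i f x) (x 0 i) (sqnorm x) w0 Xs s0.
    move=> w y d X s w0 Xs s0.
    (* Young's inequality, with weights for which the n terms in y^2 add up to
       y^2 / 2 *)
    have young : 2 * X * y * d <=
        (2 * n%:R)^-1 * y ^+ 2 + 2 * n%:R * (1 + s) * d ^+ 2.
      have k0 : 0 < 2 * n%:R :> R by rewrite mulr_gt0.
      have kK : (2 * n%:R) * (2 * n%:R)^-1 = 1 :> R by rewrite divff// gt_eqF.
      have kV : 0 < (2 * n%:R)^-1 :> R by rewrite invr_gt0.
      move: (2 * n%:R) (2 * n%:R)^-1 k0 kK kV => k l k0 kK kV.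
      have : 0 <= l * (y - k * X * d) ^+ 2 by rewrite mulr_ge0 ?sqr_ge0 ?ltW.
      have : 0 <= k * d ^+ 2 * (1 + s - X ^+ 2).
        by rewrite mulr_ge0// ?subr_ge0; [rewrite mulr_ge0 ?sqr_ge0 ?ltW|lra].
      have -> : l * (y - k * X * d) ^+ 2 = l * y ^+ 2
          - 2 * (k * l) * X * y * d + (k * l) * k * X ^+ 2 * d ^+ 2 by ring.
      rewrite kK; lra.
    rewrite -subr_ge0 in young; have := mulr_ge0 w0 young.
    rewrite -(subr_ge0 (_ + _ + _)); congr (is_true (0 <= _)); ring.
  have := ler_sum (index_enum 'I_n) (fun i (_ : xpredT i) => termwise i).
  rewrite 2!big_split /= -!mulr_sumr sumr_const card_ord -/(sqnorm x).
  have -> : c * ((1 + (2 * n%:R)^-1) *+ n) = c * (n%:R + 2^-1).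
    by rewrite -[_ *+ n]mulr_natr mulrDl mul1r invfM divfK// gt_eqF.
  rewrite -/c.
  have [x1|x1] := ltP `|x| 1.
    have -> : c = 0 by rewrite /c f0// expr0n /= mulr0.
    rewrite !(mulr0, mul0r, add0r) => sumF; lra.
  have s1 : 1 <= sqnorm x.
    have [i xi] : exists i, 1 <= `|x 0 i|.
      have /mx_norm_neq0[[j i] /= E] : mx_norm x != 0.
        by rewrite gt_eqF//; exact: lt_le_trans x1.
      by exists i; rewrite (le_trans x1)// [`|x|]E (ord1 j).
    apply: le_trans (sqr_coord_le x i).
    by rewrite -[leRHS]real_normK ?num_real// exprn_ege1.
  (* |x|^2 / (1 + |x|^2) is at least 1/2 for |x| >= 1 *)
  have vs : 1 <= 2 * v * sqnorm x.
    rewrite /v -mulrA mulrCA mulrC ler_pdivlMr ?base_gt0//; lra.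
  have bn : (n%:R + 1 : R) <= b.+1%:R by rewrite natr1 ler_nat.
  have : n%:R + 1 <= b.+1%:R * (2 * v * sqnorm x).
    by apply: (le_trans bn); rewrite ler_pMr// ltr0n.
  move=> /(ler_wpM2l c0); lra.
have Ccsum : Cc (fun x => \sum_i weight b x * partial i f x ^+ 2).
  exact: Cc_sum.
have CcsF : Cc (fun x => \sum_i partial i (F i) x) by exact: Cc_sum.
have CcZ a g : Cc g -> Cc (fun x => a * g x).
  by apply: CcMl; exact: cst_continuous.
have := le_intRn (CcZ 2^-1 _ Ccwf) (CcB (CcZ (2 * n%:R) _ Ccsum) CcsF)
  pointwise.
rewrite intRnB ?intRnZ//; last exact: CcZ.
rewrite I0 subr0 intRn_sum//; lra.
Qed.

(** Iteration of the Hardy inequality, applied at the exponents n + j, ...,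
    n + 1; the remaining weight is at most 1. *)
Lemma weighted_energy j f : (0 < n)%N -> Ccsmooth f ->
  (forall x, `|x| < 1 -> f x = 0) ->
  intRn (fun x => weight (n + j) x * f x ^+ 2) <= (4 * n%:R) ^+ j * energy j f.
Proof.
move=> n0; elim: j f => [|j IH] f tf f0.
  have Cf2 : Cc (fun x => f x ^+ 2) := Ccsmooth_CcM tf tf.
  rewrite expr0 mul1r /=; apply: le_intRn => //.
    exact: (CcMl (@continuous_weight _) Cf2).
  by move=> x; rewrite ler_piMl ?sqr_ge0// weight_le1.
rewrite addnS; apply: le_trans (weighted_hardy n0 _ (tf.1 1%N) tf.2 f0) _.
  by rewrite ltnS leq_addr.
rewrite exprS -[leRHS]mulrA ler_pM2l; last by rewrite mulr_gt0// ltr0n.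
rewrite mulr_sumr; apply: ler_sum => i _.
apply: IH => [|x x1]; first exact: Ccsmooth_partial.
have dfx : derivable f x (delta_mx 0 i) by exact: Ck_derivable (tf.1 1%N).
exact: is_derive_ball0 x1 f0 (is_derive_partial dfx).
Qed.

End hardy.

(** * Chains of radial Laplace equations on a half-line *)

Section radial_ode.
Context {R : realType}.
Implicit Types (f df v D w : R -> R) (c r : R).

Lemma nondecreasing_from f df (a : R) :
  (forall r, a <= r -> is_derive r 1 f (df r)) ->
  (forall r, a < r -> 0 <= df r) -> forall r, a <= r -> f a <= f r.
Proof.
move=> fdf df0 r; rewrite le_eqVlt => /predU1P[->//|ar].
have [s|s /andP[as_ _] E] := @mean_value R f df a r ar.
  by move=> /andP[/fdf].
by rewrite -subr_ge0 E mulr_ge0 ?subr_ge0 ?(ltW ar)// df0.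
Qed.

(** The equation r^(1-n) (r^(n-1) v')' = w in dimension n = N + 1, with v' = D,
    written for the flux r^N D because this quantity is regular at r = 0 and
    vanishes there. *)
Definition radial_laplacian (N : nat) v D w :=
  [/\ forall r, is_derive r 1 v (D r),
      continuous (fun r => r ^+ N * D r),
      0 ^+ N * D 0 = 0 &
      forall r, 0 < r -> is_derive r 1 (fun r => r ^+ N * D r) (r ^+ N * w r)].

Lemma radial_laplacianN N v D w : radial_laplacian N v D w ->
  radial_laplacian N (- v) (- D) (- w).
Proof.
move=> [vD cP P0 dP]; split.
- by move=> r; exact: is_deriveN.
- have -> : (fun r => r ^+ N * (- D) r) = fun r => - (r ^+ N * D r).
    by apply/funext => r; rewrite mulrN.
  by move=> r; exact: (continuousN (cP r)).
- by rewrite fctE mulrN P0 oppr0.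
- move=> r r0.
  have -> : (fun r => r ^+ N * (- D) r) = - (fun r => r ^+ N * D r).
    by apply/funext => s; rewrite fctE mulrN.
  by rewrite fctE mulrN; apply: is_deriveN; exact: dP.
Qed.

Lemma is_derive_monomial (k : nat) (a r : R) :
  is_derive r 1 (fun s => a * s ^+ k.+1) (a * k.+1%:R * r ^+ k).
Proof.
have d := is_deriveZ a (is_deriveX k.+1 (is_derive_id r (1 : R))).
have -> : (fun s => a * s ^+ k.+1) = a \*: (id ^+ k.+1).
  by apply/funext => s; rewrite /= fctE.
have E : a *: (k.+1%:R * r ^+ k.+1.-1)%:A = a * k.+1%:R * r ^+ k :> R.
  by rewrite /GRing.scale /= mulr1 mulrA.
by rewrite -E; exact: d.
Qed.

(** The flux r^N v' grows at least like r^(N + 1), hence v' at least like r. *)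
Lemma radial_laplacian_growth N v D w c r0 : radial_laplacian N v D w ->
  0 < c -> (forall r, r0 <= r -> c <= w r) ->
  exists2 a, 0 < a & exists r1, forall r, r1 <= r -> a * r ^+ 2 <= v r.
Proof.
move=> [vD cP P0 dP] c0 wc.
pose a := c / N.+1%:R; have a0 : 0 < a by rewrite divr_gt0.
pose p := Num.max r0 1.
have p1 : 1 <= p by rewrite le_max lexx orbT.
have pr0 : r0 <= p by rewrite le_max lexx.
pose P r := r ^+ N * D r.
pose K := `|P p - a * p ^+ N.+1|.
have P_ge r : p <= r -> a * r ^+ N.+1 - K <= P r.
  move=> pr; have := @nondecreasing_from (P - (fun s => a * s ^+ N.+1))
    (fun s => s ^+ N * w s - a * N.+1%:R * s ^+ N) p _ _ r pr.
  rewrite !fctE /K => H.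
  have {H} : P p - a * p ^+ N.+1 <= P r - a * r ^+ N.+1.
    apply: H => s ps.
      apply: is_deriveB; last exact: is_derive_monomial.
      by apply: dP; apply: lt_le_trans ps; exact: lt_le_trans p1.
    rewrite subr_ge0 /a divfK// mulrC ler_wpM2l//.
      by rewrite exprn_ge0// (le_trans ler01)// (le_trans p1)// ltW.
    by apply: wc; rewrite (le_trans pr0)// ltW.
  have : - K <= P p - a * p ^+ N.+1 by exact: lerNnormlW.
  rewrite /K; lra.
have K0 : 0 <= K by exact: normr_ge0.
have D_ge r : p <= r -> a * r - K <= D r.
  move=> pr; have r1 : 1 <= r by exact: le_trans pr.
  have rN : 1 <= r ^+ N by rewrite exprn_ege1.
  rewrite -(ler_pM2l (lt_le_trans ltr01 rN)); apply: le_trans (P_ge r pr).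
  have : K * 1 <= K * r ^+ N by exact: ler_wpM2l.
  rewrite exprS; lra.
pose Z := `|v p - a / 2 * p ^+ 2 + K * p|.
have v_ge r : p <= r -> a / 2 * r ^+ 2 - K * r - Z <= v r.
  move=> pr; have := @nondecreasing_from
    (v - (fun s => a / 2 * s ^+ 2) + (fun s => K * s ^+ 1))
    (fun s => D s - a / 2 * 2%:R * s ^+ 1 + K * 1%:R * s ^+ 0) p _ _ r pr.
  rewrite !fctE => H.
  have {H} : v p - a / 2 * p ^+ 2 + K * p ^+ 1 <=
             v r - a / 2 * r ^+ 2 + K * r ^+ 1.
    apply: H => s ps.
      apply: is_deriveD (is_derive_monomial 0 K s).
      exact: is_deriveB (vD s) (is_derive_monomial 1 (a / 2) s).
    have := D_ge s (ltW ps); rewrite expr0 expr1 mulfVK; lra.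
  have : - Z <= v p - a / 2 * p ^+ 2 + K * p by exact: lerNnormlW.
  rewrite !expr1; lra.
have Z0 : 0 <= Z by exact: normr_ge0.
exists (a / 4); first by rewrite divr_gt0.
exists (Num.max p (4 * (K + Z) / a)) => r; rewrite ge_max => /andP[pr].
rewrite ler_pdivrMr// => KZr; apply: le_trans (v_ge r pr).
have r1 : 1 <= r by exact: le_trans pr.
have h1 : Z * 1 <= Z * r by exact: ler_wpM2l.
have h2 : r * (4 * (K + Z)) <= r * (r * a) by apply: ler_wpM2l => //; lra.
rewrite expr2; lra.
Qed.

(* In the application V j is (-Delta)^(m - j) u as a function of r = |x|: hence
   V m = u, and V 0 = e^u when u solves the equation. *)
Section chain.
Variables (N m : nat) (V D : nat -> R -> R).
Hypothesis chainV : forall j, (j < m)%N ->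
  radial_laplacian N (V j.+1) (D j.+1) (- V j).

Definition eventually_pos p j :=
  exists2 c, 0 < c & exists r0, forall r, r0 <= r -> c <= (-1) ^+ p * V j r.

Lemma chain_step p j : (j < m)%N -> eventually_pos p j ->
  exists2 a, 0 < a & exists r1, forall r, r1 <= r ->
    a * r ^+ 2 <= (-1) ^+ p.+1 * V j.+1 r.
Proof.
move=> /chainV chn [c c0 [r0 Vc]]; rewrite -signr_odd /=.
move: Vc; rewrite -signr_odd; case: (odd p) => /= Vc.
  have [|a a0 [r1 Ha]] := radial_laplacian_growth (r0 := r0) chn c0.
    by move=> r /Vc; rewrite expr1 mulN1r fctE.
  by exists a => //; exists r1 => r /Ha; rewrite expr0 mul1r.
have [|a a0 [r1 Ha]] :=
  radial_laplacian_growth (r0 := r0) (radial_laplacianN chn) c0.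
  by move=> r /Vc; rewrite expr0 mul1r !fctE opprK.
by exists a => //; exists r1 => r /Ha; rewrite expr1 mulN1r.
Qed.

Lemma chain_growth p j k : (j + k < m)%N -> eventually_pos p j ->
  exists2 a, 0 < a & exists r1, forall r, r1 <= r ->
    a * r ^+ 2 <= (-1) ^+ (p + k.+1) * V (j + k).+1 r.
Proof.
elim: k p j => [|k IH] p j jkm Vj.
  by rewrite addn0 addn1 in jkm *; exact: chain_step.
rewrite -addSnnS -(addSnnS j); apply: IH; first by rewrite addSnnS.
have [|a a0 [r1 Ha]] := chain_step _ Vj.
  exact: leq_ltn_trans (leq_addr _ _) jkm.
exists a => //; exists (Num.max r1 1) => r; rewrite ge_max => /andP[/Ha ar r1'].
apply: le_trans ar; by rewrite ler_peMr ?(ltW a0)// exprn_ege1.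
Qed.

Hypotheses (m_odd : odd m) (Nm : (N.+1 <= 2 * m - 1)%N).
Hypothesis V0 : V 0 = fun r => expR (V m r).

Definition linear_decay := exists2 c, 0 < c & exists r0, forall r, r0 <= r ->
  V m r <= - c * r.

Lemma quadratic_linear_decay a r1 : 0 < a ->
  (forall r, r1 <= r -> a * r ^+ 2 <= - V m r) -> linear_decay.
Proof.
move=> a0 Ha; exists a => //; exists (Num.max r1 1) => r.
rewrite ge_max => /andP[/Ha ar r1'].
have : a * (r * 1) <= a * (r * r).
  by rewrite ler_pM2l// ler_wpM2l// (le_trans ler01).
rewrite -expr2 mulr1; lra.
Qed.

Lemma growth_linear_decay : eventually_pos 0 0 -> linear_decay.
Proof.
have m0 : (0 < m)%N by case: m m_odd.
move=> /(@chain_growth 0 0 m.-1); rewrite !add0n prednK// => /(_ (leqnn _)).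
move=> [a a0 [r1 Ha]]; apply: (quadratic_linear_decay a0 (r1 := r1)) => r /Ha.
by rewrite -signr_odd m_odd expr1 mulN1r.
Qed.

(** Once some V j is bounded away from 0 on the negative side, u = V m tends
    to -oo quadratically, or else to +oo; but then V 0 = e^u is large, and
    following the whole chain, of odd length, sends u to -oo. *)
Lemma neg_linear_decay j : (0 < j < m)%N -> eventually_pos 1 j -> linear_decay.
Proof.
move=> /andP[j0 jm] Vj; have jkm : (j + (m - j).-1 < m)%N by lia.
have [a a0 [r1]] := chain_growth jkm Vj.
rewrite (_ : (j + _).+1 = m); last by lia.
rewrite -signr_odd; case: (odd _) => Ha.
  apply: (quadratic_linear_decay a0 (r1 := r1)) => r /Ha.
  by rewrite expr1 mulN1r.
apply: growth_linear_decay; exists 1 => //; exists r1 => r /Ha.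
rewrite !expr0 !mul1r => ar; rewrite V0 -expR0 ler_expR (le_trans _ ar)//.
by rewrite mulr_ge0 ?sqr_ge0 ?ltW.
Qed.

Let P j r := r ^+ N * D j r.

(** The flux starts at 0 and its derivative is - r^N V j. *)
Lemma flux_neg j : (j < m)%N -> (forall r, 0 < r -> 0 < V j r) ->
  forall r, 0 < r -> P j.+1 r < 0.
Proof.
move=> /chainV[VD cP P0 dP] Vpos r r0.
have [s||c] := @MVT _ (P j.+1) (fun s => s ^+ N * (- V j) s) 0 r r0.
- by rewrite in_itv /= => /andP[s0 _]; exact: dP.
- exact: continuous_subspaceT.
rewrite in_itv /= => /andP[c0 _].
rewrite {2}/P P0 !subr0 => ->; rewrite fctE mulrN mulNr oppr_lt0.
by rewrite !mulr_gt0 ?exprn_gt0// Vpos.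
Qed.

(** Comparison with - b r^(k + 1); shrinking b below the absolute value of the
    flux at 1 makes the comparison true at r = 1. *)
Lemma flux_le j a k : (j < m)%N -> (forall r, 0 < r -> 0 < V j r) -> 0 < a ->
  (forall r, 1 <= r -> a * r ^+ k <= r ^+ N * V j r) ->
  exists2 b, 0 < b & forall r, 1 <= r -> P j.+1 r <= - b * r ^+ k.+1.
Proof.
move=> jm Vpos a0 Va; have P1 := flux_neg jm Vpos ltr01.
have [VD cP P0 dP] := chainV jm.
pose b := Num.min (a / k.+1%:R) (- P j.+1 1).
have b0 : 0 < b by rewrite lt_min divr_gt0// oppr_gt0.
exists b => // r r1.
have := @nondecreasing_from (- P j.+1 - (fun s => b * s ^+ k.+1))
  (fun s => - (s ^+ N * (- V j) s) - b * k.+1%:R * s ^+ k) 1 _ _ r r1.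
rewrite !fctE expr1n => H.
have {H} : - P j.+1 1 - b * 1 <= - P j.+1 r - b * r ^+ k.+1.
  apply: H => s s1.
    apply: is_deriveB (is_derive_monomial k b s); apply: is_deriveN.
    by apply: dP; exact: lt_le_trans s1.
  rewrite mulrN opprK subr_ge0; apply: le_trans (Va s (ltW s1)).
  rewrite ler_wpM2r ?exprn_ge0 ?(le_trans ler01 (ltW s1))//.
  by rewrite -ler_pdivlMr// ge_min lexx.
have : b <= - P j.+1 1 by rewrite ge_min lexx orbT.
lra.
Qed.

(** By positivity V j r >= V j r - V j (2 r), and the mean value theorem on
    the interval [r, 2 r] bounds this drop from below by the flux. *)
Lemma flux_lower_bound j a k : (0 < j <= m)%N ->
  (forall r, 0 < r -> 0 < V j r) -> 0 < a ->
  (forall r, 1 <= r -> P j r <= - a * r ^+ k) ->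
  forall r, 1 <= r -> a / 2 ^+ N * r ^+ k.+1 <= r ^+ N * V j r.
Proof.
case: j => // j /= jm Vpos a0 Pa r r1.
have [VD _ _ _] := chainV jm.
have r0 : 0 < r by exact: lt_le_trans r1.
have r2 : r < 2 * r by lra.
have [c /andP[rc c2r] E] := mean_value r2 (fun s _ => VD s).
have Vr : - D j.+1 c * r <= V j.+1 r.
  have := Vpos (2 * r); rewrite mulr_gt0// => /(_ isT); move: E; lra.
have c1 : 1 <= c by rewrite (le_trans r1)// ltW.
have Pc : a * r ^+ k <= c ^+ N * (- D j.+1 c).
  have := Pa c c1; rewrite /P mulrN => h.
  have : a * r ^+ k <= a * c ^+ k.
    by rewrite ler_pM2l// lerXn2r ?nnegrE// ltW// (lt_trans r0).
  lra.
have D0 : 0 <= - D j.+1 c.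
  rewrite -(pmulr_rge0 _ (_ : 0 < c ^+ N)) ?exprn_gt0 ?(lt_le_trans _ c1)//.
  by apply: le_trans Pc; rewrite mulr_ge0 ?exprn_ge0 ?ltW.
have cN : c ^+ N <= (2 * r) ^+ N.
  by rewrite lerXn2r ?nnegrE// ltW// ?(lt_le_trans _ c1)// mulr_gt0.
rewrite mulrAC ler_pdivrMr ?exprn_gt0//.
apply: (@le_trans _ _ (r * ((2 * r) ^+ N * (- D j.+1 c)))).
  by rewrite exprS mulrCA ler_pM2l// (le_trans Pc)// ler_wpM2r.
rewrite exprMn; have h := ler_wpM2l (exprn_ge0 N (ltW r0)) Vr.
have := ler_wpM2r (exprn_ge0 N (ler0n R 2)) h; lra.
Qed.

(** Going from j to j + 1, the decreasing function V (j + 1) either takes a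
    value <= 0, hence is eventually below a negative constant, or is positive
    and yields the flux bound two powers higher. *)
Lemma chain_dichotomy j : (j < m)%N -> linear_decay \/
  ((forall r, 0 < r -> 0 < V j r) /\
   exists2 a, 0 < a & forall r, 1 <= r -> P j.+1 r <= - a * r ^+ j.*2).
Proof.
elim: j => [|j IH] jm.
  right; have Vpos r : 0 < r -> 0 < V 0 r by move=> _; rewrite V0 expR_gt0.
  split => //; have P1 := flux_neg jm Vpos ltr01.
  exists (- P 1 1); rewrite ?oppr_gt0// => r r1; rewrite opprK mulr1.
  have [VD cP P0 dP] := chainV jm.
  rewrite -lerN2; apply: (nondecreasing_from (f := - P 1)
    (df := fun s => - (s ^+ N * (- V 0) s))) r1 => s s1.
    by apply: is_deriveN; apply: dP; exact: lt_le_trans s1.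
  by rewrite mulrN opprK mulr_ge0 ?exprn_ge0 ?ltW ?Vpos// (lt_trans ltr01).
have jm' : (j < m)%N by exact: ltnW.
have [|[Vpos [a a0 Pa]]] := IH jm'; first by left.
have Pneg := flux_neg jm' Vpos.
have [VD _ _ _] := chainV jm'.
have Dneg r : 0 < r -> D j.+1 r < 0.
  by move=> r0; have := Pneg r r0; rewrite /P pmulr_rlt0// exprn_gt0.
have [Vpos'|/existsNP[q /not_implyP[q0 /negP]]] :=
  pselect (forall r, 0 < r -> 0 < V j.+1 r).
  right; split=> //.
  have := flux_lower_bound (j := j.+1) jm' Vpos' a0 Pa.
  move=> /(flux_le jm Vpos'); rewrite doubleS; apply.
  by rewrite divr_gt0// exprn_gt0.
rewrite -leNgt => Vq; left; apply: (@neg_linear_decay j.+1 jm).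
have decr r s : 0 < r -> r < s -> V j.+1 s < V j.+1 r.
  move=> r0 rs; have [c /andP[rc _] E] := mean_value rs (fun s _ => VD s).
  by rewrite -subr_lt0 E nmulr_rlt0 ?subr_gt0// Dneg// (lt_trans r0).
have q1 : q < q + 1 by rewrite ltrDl.
have q10 : 0 < q + 1 by rewrite (lt_trans q0).
have Vq1 : V j.+1 (q + 1) < 0 by exact: lt_le_trans (decr _ _ q0 q1) Vq.
exists (- V j.+1 (q + 1)); first by rewrite oppr_gt0.
exists (q + 1) => r; rewrite le_eqVlt expr1 mulN1r => /predU1P[->//|qr].
by rewrite lerN2 ltW// decr.
Qed.

(** The last flux bound, r^N u' <= - a r^(2m - 2), gives u' <= - a precisely
    because N <= 2m - 2. *)
Lemma chain_linear_decay : linear_decay.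
Proof.
have m0 : (0 < m)%N by case: m m_odd.
have m1 : (m.-1 < m)%N by rewrite prednK.
case: (chain_dichotomy m1) => [//|[_ [a a0]]].
rewrite (prednK m0) => Pa.
have := chainV m1; rewrite prednK// => -[VD _ _ _].
have Da r : 1 <= r -> D m r <= - a.
  move=> r1; have r0 : 0 < r by exact: lt_le_trans r1.
  have rN : 0 < r ^+ N by rewrite exprn_gt0.
  rewrite -(ler_pM2l rN); apply: le_trans (Pa r r1) _.
  rewrite mulrN mulNr lerN2 [leLHS]mulrC ler_pM2l//.
  by rewrite ler_weXn2l//; lia.
exists (a / 2); first by rewrite divr_gt0.
exists (Num.max 1 (2 * (V m 1 + a) / a)) => r; rewrite ge_max => /andP[r1].
rewrite ler_pdivrMr// => Vr.
have := @nondecreasing_from (- V m - (fun s => a * s ^+ 1))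
  (fun s => - D m s - a * 1%:R * s ^+ 0) 1 _ _ r r1.
rewrite !fctE expr1n expr1 => H.
have : - V m 1 - a * 1 <= - V m r - a * r.
  apply: H => s s1.
  by have := Da s (ltW s1); lra.
lra.
Qed.

End chain.
End radial_ode.

(** * Radial functions *)

Section radial_functions.
Context {R : realType} {N : nat}.
Implicit Types (x : 'rV[R]_N.+1) (v : 'rV[R]_N.+1 -> R) (r s t : R).

Let e1 : 'rV[R]_N.+1 := delta_mx 0 ord0.

Lemma enormE x : enorm x = Num.sqrt (sqnorm x).
Proof. by []. Qed.

Lemma sqr_enorm x : enorm x ^+ 2 = sqnorm x.
Proof. by rewrite sqr_sqrtr// sqnorm_ge0. Qed.

Lemma enorm_axis t : enorm (t *: e1) = `|t|.
Proof.
rewrite enormE /sqnorm big_ord_recl big1 => [|i _]; last first.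
  by rewrite !mxE /= mulr0 expr0n.
by rewrite !mxE /= mulr1 addr0 sqrtr_sqr.
Qed.

Lemma sqnorm_gt0 x : x != 0 -> 0 < sqnorm x.
Proof.
move=> x0; rewrite lt_neqAle sqnorm_ge0 andbT eq_sym.
apply: contra x0 => /eqP q0; apply/eqP/rowP => i; rewrite mxE; apply/eqP.
by rewrite -sqrf_eq0 eq_le sqr_ge0 andbT -q0 sqr_coord_le.
Qed.

Lemma enorm_gt0 x : x != 0 -> 0 < enorm x.
Proof. by move=> x0; rewrite sqrtr_gt0 sqnorm_gt0. Qed.

Lemma norm_le_enorm x : `|x| <= enorm x.
Proof.
apply: norm_le; first exact: sqrtr_ge0.
by move=> i; rewrite -sqrtr_sqr ler_wsqrtr// sqr_coord_le.
Qed.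

Lemma is_derive_comp_dir (g : R -> R) (q : 'rV[R]_N.+1 -> R) x i a b :
  is_derive x (delta_mx 0 i) q a -> is_derive (q x) 1 g b ->
  is_derive x (delta_mx 0 i) (fun y => g (q y)) (b * a).
Proof.
move=> /is_derive_line0 qa gb; apply/is_derive_line0.
apply: (@is_derive1_comp _ g (fun s : R => q (x + s *: delta_mx 0 i))).
by rewrite scale0r addr0.
Qed.

Lemma is_derive_enorm x i : x != 0 ->
  is_derive x (delta_mx 0 i) (@enorm R N.+1) (x 0 i / enorm x).
Proof.
move=> x0; have q0 := sqnorm_gt0 x0.
have dq : is_derive x (delta_mx 0 i) sqnorm (2 * x 0 i).
  have dqx : derivable sqnorm x (delta_mx 0 i).
    exact: Ck_derivable Ck1_sqnorm.
  by have := is_derive_partial dqx; rewrite partial_sqnorm.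
have := is_derive_comp_dir dq (is_derive1_sqrt q0).
by rewrite invfM mulrAC mulrA mulVf// mul1r mulrC.
Qed.

Section radial_profile.
Variable v : 'rV[R]_N.+1 -> R.
Hypotheses (Cv : Ck 2 v) (rv : radial v).

(** A radial function is read off on the first coordinate axis, negative half
    included: this makes the profile differentiable, and even, at 0. *)
Definition profile (f : 'rV[R]_N.+1 -> R) r := f (r *: e1).

Let D := profile (partial ord0 v).
Let DD := profile (partial ord0 (partial ord0 v)).

Lemma radialE x : v x = profile v (enorm x).
Proof.
have [g vg] := rv; rewrite /profile !vg enorm_axis ger0_norm//.
exact: sqrtr_ge0.
Qed.

Lemma is_derive_profile f r : Ck 1 f ->
  is_derive r 1 (profile f) (profile (partial ord0 f) r).
Proof.
move=> Cf.
have df : derivable f (0 + r *: e1) (delta_mx 0 ord0) by exact: Ck_derivable Cf.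
have /is_derive_line := is_derive_partial df.
by rewrite add0r; under eq_fun do rewrite add0r.
Qed.

Let Cdv i : Ck 1 (partial i v). Proof. exact: Ck_partial. Qed.

(** Needed in dimension one, where the factor r^(n-1) does not make the flux
    vanish at 0. *)
Lemma profile_derivative0 : D 0 = 0.
Proof.
have dv := is_derive_profile 0 (CkS Cv).
have even : profile v \o -%R = profile v.
  by apply/funext => r; rewrite /= /profile !radialE !enorm_axis normrN.
have := @is_derive1_comp R (profile v) -%R 0 (profile (partial ord0 v) 0) (-1) .
rewrite oppr0 => /(_ dv (is_deriveNid _ _)); rewrite even => dv'.
have := @derive_val _ _ _ _ _ _ _ dv; rewrite (@derive_val _ _ _ _ _ _ _ dv').
rewrite -/D; lra.
Qed.

Lemma partial_radial x i : x != 0 ->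
  partial i v x = D (enorm x) / enorm x * x 0 i.
Proof.
move=> x0; apply: partial_val.
have -> : v = fun y => profile v (enorm y) by apply/funext => y; exact: radialE.
rewrite mulrAC -mulrA; apply: is_derive_comp_dir; first exact: is_derive_enorm.
exact: is_derive_profile (CkS Cv).
Qed.

Lemma near_neq0 x : x != 0 -> \forall y \near x, y != 0.
Proof.
move=> x0; near=> y; rewrite -normr_gt0; near: y.
apply: (@cvgr_norm_gt _ _ _ (nbhs x) _ id x cvg_id 0); by rewrite normr_gt0.
Unshelve. all: by end_near. Qed.

Lemma partial2_radial x i : x != 0 ->
  partial i (partial i v) x =
  (DD (enorm x) - D (enorm x) / enorm x) / enorm x ^+ 2 * x 0 i ^+ 2
  + D (enorm x) / enorm x.
Proof.
move=> x0; apply: partial_val.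
apply: (@near_eq_is_derive _ _ _
    (fun y => (D (enorm y) / enorm y) * y 0 i)).
  near=> y; rewrite partial_radial//; near: y; exact: near_neq0.
have r0 := enorm_gt0 x0; set r := enorm x in r0 *.
have dD : is_derive r 1 D (DD r) by exact: is_derive_profile.
have rn0 := lt0r_neq0 r0.
have dV : is_derive r 1 (fun s : R => s^-1) (- r ^- 2).
  split; first exact: (@derivableV R R id r 1 rn0 (@derivable_id _ _ r 1)).
  apply: etrans (@deriveV R R id r 1 rn0 (@derivable_id _ _ r 1)) _.
  by rewrite derive_id [_ *: _]mulr1.
have dH : is_derive r 1 (fun s => D s / s) (DD r / r - D r / r ^+ 2).
  have -> : DD r / r - D r / r ^+ 2 = D r *: (- r ^- 2) + r^-1 *: DD r.
    by rewrite /GRing.scale /=; field.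
  exact: (is_deriveM dD dV).
apply: is_derive_eq.
  exact: (is_deriveM (is_derive_comp_dir (is_derive_enorm i x0) dH)
                     (is_derive_coord x (delta_mx 0 i) i)).
rewrite mxE !eqxx /GRing.scale /= -/r mulr1.
have := lt0r_neq0 r0.
by move=> ?; field.
Unshelve. all: by end_near. Qed.

Lemma laplacian_radial x : x != 0 ->
  laplacian v x = DD (enorm x) + N%:R * D (enorm x) / enorm x.
Proof.
move=> x0; have r0 := lt0r_neq0 (enorm_gt0 x0).
rewrite /laplacian; under eq_bigr do rewrite partial2_radial//.
rewrite big_split /= -mulr_sumr -/(sqnorm x) -sqr_enorm sumr_const card_ord.
by rewrite -[_ *+ N.+1]mulr_natr -natr1; field.
Qed.

Lemma radial_laplacian_radial : radial (laplacian v).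
Proof.
exists (fun r => if r == 0 then laplacian v 0 else DD r + N%:R * D r / r) => x.
have [->|x0] := eqVneq x 0.
  have := enorm_axis 0; rewrite scale0r normr0 => ->; by rewrite eqxx.
by rewrite gt_eqF ?enorm_gt0// laplacian_radial.
Qed.

Lemma profile_radial_laplacian :
  radial_laplacian N (profile v) D (profile (laplacian v)).
Proof.
have cD : continuous D.
  move=> r.
  have := continuous_line (x := 0) (v := e1) (Ck_continuous (Cdv ord0)).
  by under eq_fun do rewrite add0r; apply.
split.
- by move=> r; exact: is_derive_profile (CkS Cv).
- by move=> r; exact: (continuousM (@exprn_continuous _ N r) (cD r)).
- by rewrite profile_derivative0 mulr0.
- move=> r r0; have dD : is_derive r 1 D (DD r) by exact: is_derive_profile.
  have re0 : r *: e1 != 0.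
    apply/eqP => re; have := enorm_axis r.
    rewrite re -(scale0r e1) enorm_axis normr0 gtr0_norm// => E.
    by rewrite -E ltxx in r0.
  have dN : is_derive r 1 (fun s : R => s ^+ N) (N%:R * r ^+ N.-1).
    split; first exact: exprn_derivable.
    by rewrite exp_derive /GRing.scale /= mulr1.
  have pow : N%:R * r ^+ N = N%:R * r ^+ N.-1 * r.
    by case: (N) => [|k]; rewrite ?mul0r// exprSr mulrA.
  have -> : r ^+ N * profile (laplacian v) r =
            r ^+ N *: DD r + D r *: (N%:R * r ^+ N.-1).
    rewrite /profile laplacian_radial// enorm_axis (gtr0_norm r0).
    rewrite mulrDr /GRing.scale /=; congr (_ + _).
    rewrite mulrA mulrA [r ^+ N * _]mulrC pow.
    by field; exact: lt0r_neq0.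
  exact: (is_deriveM dN dD).
Qed.

End radial_profile.
End radial_functions.

(** * Decay of radial solutions *)

Section decay.
Context {R : realType} {N : nat}.
Implicit Types (u : 'rV[R]_N.+1 -> R).

Let negL u := fun y => - laplacian u y.

Lemma iter_negL_Ck k l u : Ck (2 * k + l) u -> Ck l (iter k negL u).
Proof.
elim: k l => [//|k IH] l Cu /=; apply: CkN; apply: Ck_laplacian.
by apply: IH; apply: Ck_leq Cu; lia.
Qed.

Lemma iter_negL_radial k u : Ck (2 * k) u -> radial u -> radial (iter k negL u).
Proof.
elim: k => [//|k IH] Cu ru /=.
have ru' : radial (iter k negL u).
  by apply: IH => //; apply: Ck_leq Cu; rewrite leq_mul2l leqnSn.
have C2 : Ck 2 (iter k negL u) by apply: iter_negL_Ck; apply: Ck_leq Cu; lia.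
have [g Lg] := radial_laplacian_radial C2 ru'.
by exists (fun r => - g r) => x; rewrite /negL Lg.
Qed.

Lemma radial_solution_decay m u : odd m -> (N.+1 <= 2 * m - 1)%N ->
  solution m u -> radial u ->
  exists2 c : R, 0 < c & exists r0, forall x, r0 <= enorm x ->
    u x <= - c * enorm x.
Proof.
move=> m_odd Nm [Cu Eu] ru.
pose V j := profile (iter (m - j) negL u).
pose D j := profile (partial ord0 (iter (m - j) negL u)).
have chainV j : (j < m)%N -> radial_laplacian N (V j.+1) (D j.+1) (- V j).
  move=> jm; pose f := iter (m - j.+1) negL u.
  have Cf : Ck 2 f by apply: iter_negL_Ck; apply: Ck_leq Cu; lia.
  have rf : radial f by apply: iter_negL_radial => //; apply: Ck_leq Cu; lia.
  have := profile_radial_laplacian Cf rf.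
  have -> // : profile (laplacian f) = - V j.
  apply/funext => r; rewrite fctE /V /profile.
  by rewrite (_ : (m - j = (m - j.+1).+1)%N) ?opprK//; lia.
have V0 : V 0 = fun r => expR (V m r).
  by apply/funext => r; rewrite /V /profile subn0 subnn /= Eu.
have [c c0 [r0 Vc]] := chain_linear_decay chainV m_odd Nm V0.
exists c => //; exists r0 => x /Vc; rewrite /V subnn /=.
by rewrite -radialE.
Qed.

Lemma expR_ge_pow (k : nat) (x : R) : 0 <= x -> (x / k.+1%:R) ^+ k.+1 <= expR x.
Proof.
move=> x0; have -> : expR x = expR (x / k.+1%:R) ^+ k.+1.
  by rewrite -expRM_natl mulrC divfK.
have xk : 0 <= x / k.+1%:R by rewrite divr_ge0.
rewrite lerXn2r ?nnegrE ?expR_ge0//.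
by apply: le_trans (expR_ge1Dx _); rewrite lerDr.
Qed.

(** The exponential beats the power 2b + 1 of r, one more than the weight
    needs. *)
Lemma exp_le_weight (b : nat) (c e : R) : 0 < c -> 0 < e ->
  exists2 p, 1 <= p & forall x : 'rV[R]_N.+1, p <= enorm x ->
    expR (- c * enorm x) <= e * weight b x.
Proof.
move=> c0 e0; pose k := b.*2.
pose d := (c / k.+1%:R) ^+ k.+1.
have d0 : 0 < d by rewrite exprn_gt0// divr_gt0.
exists (Num.max 1 (2 ^+ b / (d * e))); first by rewrite le_max lexx.
move=> x; rewrite ge_max => /andP[r1]; rewrite ler_pdivrMr ?mulr_gt0// => rb.
rewrite /weight -sqr_enorm exprVn mulNr expRN.
move: (enorm x) r1 rb => r r1 rb; have r0 : 0 < r by lra.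
have q0 : 0 < 1 + r ^+ 2 by rewrite ltr_pwDl// sqr_ge0.
rewrite ler_pdivlMr ?exprn_gt0// mulrC ler_pdivrMr ?expR_gt0//.
apply: (@le_trans _ _ (2 ^+ b * r ^+ k)).
  have r2 : 1 <= r ^+ 2 by rewrite exprn_ege1.
  rewrite /k -mul2n exprM -exprMn; apply: lerXn2r; rewrite ?nnegrE; lra.
have := expR_ge_pow k (mulr_ge0 (ltW c0) (ltW r0)).
rewrite mulrAC exprMn -/d => dr; have := ler_wpM2l (ltW e0) dr.
apply: le_trans; rewrite exprSr mulrA mulrA.
have := ler_wpM2r (exprn_ge0 k (ltW r0)) rb; lra.
Qed.

End decay.

Theorem theorem3p3 (R : realType) (m n : nat) (hm : (1 <= m)%N) (hodd : odd m)
    (hn : (1 <= n <= 2 * m - 1)%N) (u : 'rV[R]_n -> R)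
    (hu : solution m u) (hrad : radial u) :
  stable_outside_compact_set m u.
Proof.
case: n hn u hu hrad => [//|N] /= Nm u hu hrad.
have [c c0 [r0 uc]] := radial_solution_decay hodd Nm hu hrad.
(* the constant of weighted_energy at order m: outside the cube K, e^u has to
   be at most C^-1 times the weight *)
pose C : R := (4 * N.+1%:R) ^+ m.
have C0 : 0 < C by rewrite exprn_gt0// mulr_gt0.
have CV0 : 0 < C^-1 by rewrite invr_gt0.
have [p p1 eW] := @exp_le_weight R N (N.+1 + m) c C^-1 c0 CV0.
pose q := Num.max p r0.
pose K := [set x : 'rV[R]_N.+1 | forall i, `[- q, q]%classic (x 0 i)].
exists K; split.
  by apply: (@rV_compact _ _ (fun=> `[- q, q]%classic)) => i;
    exact: segment_compact.
move=> phi [Sphi cphi Kphi].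
have phi0 x : `|x| < q -> phi x = 0.
  move=> xq; apply: contrapT => /eqP px.
  apply: (Kphi x); first exact: subset_closure.
  move=> i; rewrite /= in_itv /= -ler_norml.
  by rewrite (le_trans (coord_le_norm _ _))// ltW.
have sphi : compactly_supported phi.
  have [M [_ HM]] := compact_bounded cphi.
  exists (M + 1) => x Mx; apply: contrapT => /eqP px.
  have xS : closure [set x | phi x != 0] x by exact: subset_closure.
  have := HM (M + 1); rewrite ltrDl => /(_ ltr01 x xS) /=.
  by rewrite leNgt Mx.
have tphi : Ccsmooth phi by split.
have cu : continuous u := Ck_continuous hu.1.
have ceu : continuous (fun x => expR (u x)).
  by move=> x; apply: continuous_comp; [exact: cu|exact: continuous_expR].
have Cphi2 : Cc (fun x => phi x ^+ 2) := Ccsmooth_CcM tphi tphi.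
rewrite subr_ge0.
have mk : m = ((m - 1)./2).*2.+1.
  rewrite -{2}(odd_double_half m) hodd addKn doubleK.
  by rewrite -[LHS]odd_double_half hodd.
rewrite -energy1E; last exact: Ccsmooth_iter_laplacian.
rewrite -energy_iter_laplacian// -mk.
apply: (@le_trans _ _
  (C^-1 * intRn (fun x => weight (N.+1 + m) x * phi x ^+ 2))).
  have CW : Cc (fun x => weight (N.+1 + m) x * phi x ^+ 2).
    exact: CcMl (@continuous_weight _ _ _) Cphi2.
  rewrite -intRnZ//; apply: le_intRn.
  - exact: CcMl ceu Cphi2.
  - by apply: CcMl CW; exact: cst_continuous.
  move=> x; have [xq|qx] := ltP `|x| q.
    by rewrite phi0// expr0n /= !mulr0.
  rewrite mulrA ler_wpM2r ?sqr_ge0//.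
  have := le_trans qx (norm_le_enorm x); rewrite ge_max => /andP[px rx].
  by apply: le_trans (eW _ px); rewrite ler_expR uc.
rewrite mulrC ler_pdivrMr// mulrC; apply: weighted_energy => //.
move=> x x1; apply: phi0; apply: lt_le_trans x1 _.
by rewrite le_max p1.
Qed.
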